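(* Fix $\nu\in(0,1]$, $k\in\mathbb{N}$, $\lambda_1,\dots,\lambda_k>0$, $\Lambda=\lambda_1+\dots+\lambda_k$. Let $N^\nu_\Lambda(t)$ be a fractional Poisson process with intensity $\Lambda$, and $(X_i)_{i\ge1}$ i.i.d., independent of $N^\nu_\Lambda$, with $\mathbb{P}\{X_i=j\}=\lambda_j/\Lambda$, $j=1,\dots,k$. Let $M^\nu(t)=\sum_{i=1}^{N^\nu_\Lambda(t)}X_i$ and, for $j\in\{1,\dots,k\}$, $M^\nu_j(t)=\sum_{i=1}^{N^\nu_\Lambda(t)}\mathbf{1}_{\{X_i=j\}}$ (the number of jumps of amplitude $j$ in $(0,t]$) and $H_j=\inf\{s>0:M^\nu_j(s)=1\}$. Then \[ \mathbb{P}\{H_j\le t\}=\lambda_j t^\nu E_{\nu,\nu+1}(-\lambda_jt^\nu),\qquad t>0. \]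
   Context: The fractional Poisson process $N^\nu_\lambda(t)$ with intensity $\lambda>0$ is the renewal process (with $N^\nu_\lambda(0)=0$) whose i.i.d. interarrival times have density $\lambda t^{\nu-1}E_{\nu,\nu}(-\lambda t^\nu)$, $t>0$, where $E_{\alpha,\beta}(x)=\sum_{r\ge0}\frac{x^r}{\Gamma(\alpha r+\beta)}$ is the two-parameter Mittag-Leffler function. *)

(* Defs.v *)
From HB Require Import structures.
From mathcomp Require Import all_boot all_order all_algebra.
From mathcomp Require Import all_classical all_reals all_analysis.
Set Implicit Arguments. Unset Strict Implicit. Unset Printing Implicit Defensive.
Import Order.TTheory GRing.Theory Num.Theory.
Import numFieldNormedType.Exports.
Local Open Scope classical_set_scope.
Local Open Scope ring_scope.

Definition Gamma {R : realType} (s : R) : R :=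
  Rintegral (@lebesgue_measure R) `]0%R, +oo[ (fun x => x `^ (s - 1) * expR (- x)).

Definition mittag_leffler {R : realType} (a b x : R) : R :=
  lim (series (fun r : nat => x ^+ r / Gamma (a * r%:R + b)) @ \oo).

Definition mutually_independent {d : measure_display} {T : measurableType d}
  {R : realType} (P : probability T R) {I : eqType} (Y : I -> T -> R) : Prop :=
  forall (s : seq I) (B : I -> set R), uniq s ->
    (forall i, measurable (B i)) ->
    P (\big[setI/setT]_(i <- s) (Y i @^-1` B i)) =
    (\prod_(i <- s) P (Y i @^-1` B i))%E.

(** Arrival times: S_n = J_1 + ... + J_n, where [J i] is the (i+1)-th interarrival time. *)
Definition arrival_time {T : Type} {R : realType} (J : nat -> T -> R) (n : nat) (w : T) : R :=
  \sum_(i < n) J i w.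

(** Renewal counting process N(t) = max {n >= 0 : S_n <= t}
    (defaults to 0 on the event where this maximum does not exist). *)
Definition renewal_count {T : Type} {R : realType} (J : nat -> T -> R) (t : R) (w : T) : nat :=
  xget 0%N [set n : nat | (arrival_time J n w <= t) /\
                          (forall m : nat, arrival_time J m w <= t -> (m <= n)%N)].

(** M_j(t) = sum_{i=1}^{N(t)} 1{X_i = j}  ([X i] is the mark X_{i+1}). *)
Definition jump_count {T : Type} {R : realType} (J : nat -> T -> R) (X : nat -> T -> R)
  (j : nat) (t : R) (w : T) : nat :=
  \sum_(i < renewal_count J t w) (X i w == j%:R : nat).

(** H_j = inf {s > 0 : M_j(s) = 1}, as an extended real (inf of the empty set is +oo). *)
Definition first_hit {T : Type} {R : realType} (J : nat -> T -> R) (X : nat -> T -> R)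
  (j : nat) (w : T) : \bar R :=
  ereal_inf [set s%:E | s in [set s : R | 0 < s /\ jump_count J X j s w = 1%N]].

(* Main.v *)
(* Conditioning on the index of the first jump of amplitude j gives, with p = lambda_j / Lambda
   and q = 1 - p, P(H_j <= t) = sum_n p q^n F_{n+1}(t), where F_n is the distribution function
   of the n-th arrival time; the only exceptional paths are those with a nonpositive
   interarrival time. The partial sums A_n satisfy A_{n+1} = f * (p + q A_n), f being the
   interarrival density. With g_m(t) = t^(nu m) / Gamma(nu m + 1), the beta integral gives
   f * g_m = Lambda (g_{m+1} - f * g_{m+1}), so that the partial sums
   G_N = sum_{m < N} (-1)^m lambda_j^(m+1) g_{m+1} of the claimed series satisfy the same
   equation up to an error p lambda_j^N g_N. Since q < 1 the equation is contracting, and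
   A_n(t) and G_N(t) have the same limit. *)
Require Import Defs.
From HB Require Import structures.
From mathcomp Require Import all_boot all_order all_algebra.
From mathcomp Require Import all_classical all_reals all_analysis.
From mathcomp Require Import measurable_realfun ring.
Set Implicit Arguments. Unset Strict Implicit. Unset Printing Implicit Defensive.
Import Order.TTheory GRing.Theory Num.Theory.
Import numFieldNormedType.Exports.
Local Open Scope classical_set_scope.
Local Open Scope ring_scope.

(** * The gamma function and the beta integral *)

Section gamma_function.
Context {R : realType}.
Local Notation mu := (@lebesgue_measure R).
Implicit Types a b c t x : R.

(** The renewal equation is iterated in real time, so no transform has to be inverted, and all
    estimates are uniform on ]0, t] for one fixed horizon t. The number n of mark terms and the
    number m of series terms are truncated independently: contraction gives |A_n - G_m| <= l^m
    g_m(t) + q^n c_m, with c_m a bound for |G_m|. Letting n grow with m fixed leaves l^m g_m(t),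
    which is the m-th term of E_{nu,1}(l t^nu) and hence tends to 0. Only finite combinations of the
    g_m and of the F_n are convolved with the interarrival law; the one interchange of the density
    series with an integral is the dominated convergence behind the recurrence for f * g_m.
    Explosion of the arrival times need not be excluded: H_j is decided at a single arrival time,
    all later ones being strictly larger. *)

Lemma powR_within_continuous a x y : 0 < x ->
  {within `[x, y], continuous (fun s : R => s `^ a)}.
Proof.
move=> x0; apply: continuous_in_subspaceT => z; rewrite inE/= in_itv/= => /andP[xz _].
apply: differentiable_continuous; apply/derivable1_diffP.
by apply: derivable_powR; rewrite in_itv/= andbT (lt_le_trans x0).
Qed.

Lemma integral_powR_away0 a x y : 0 < a -> 0 < x -> x < y ->
  (\int[mu]_(s in `[x, y]) (s `^ (a - 1))%:E = (y `^ a / a - x `^ a / a)%:E)%E.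
Proof.
move=> a0 x0 xy; rewrite EFinB.
have dF z : 0 < z -> derivable (fun s : R => s `^ a / a) z 1.
  move=> z0; apply: derivableM => //.
  by apply: derivable_powR; rewrite in_itv/= andbT.
apply: (@continuous_FTC2 _ _ (fun s : R => s `^ a / a)) => //.
- exact: powR_within_continuous.
- have cF z : 0 < z -> {for z, continuous (fun s : R => s `^ a / a)}.
    by move=> z0; apply: differentiable_continuous; apply/derivable1_diffP; exact: dF.
  split.
  + by move=> z; rewrite in_itv/= => /andP[xz _]; apply: dF; exact: lt_trans xz.
  + by apply: cvg_at_right_filter; exact: cF.
  + by apply: cvg_at_left_filter; apply: cF; exact: lt_trans xy.
- move=> z; rewrite in_itv/= => /andP[xz _].
  have z0 : 0 < z by exact: lt_trans xz.
  under eq_fun do rewrite mulrC.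
  rewrite derive1Ml ?powR_derive1 ?in_itv/= ?andbT//; last first.
    by apply: derivable_powR; rewrite in_itv/= andbT.
  by rewrite mulrA mulVf ?gt_eqF// mul1r.
Qed.

Lemma integral_powR a t : 0 < a -> 0 < t ->
  (\int[mu]_(s in `]0%R, t]) (s `^ (a - 1))%:E = (t `^ a / a)%:E)%E.
Proof.
move=> a0 t0.
(* The fundamental theorem is applied away from 0, where the power may blow up. With [i.+2] the left
   endpoint is strictly below [t] already for [i = 0], as [integral_powR_away0] requires. *)
pose F i := `[t / i.+2%:R, t]%classic.
have -> : `]0%R, t]%classic = \bigcup_i F i.
  apply/seteqP; split => x /=; last first.
    move=> [i _]; rewrite /F/= !in_itv/= => /andP[+ ->]; rewrite andbT.
    by apply: lt_le_trans; rewrite divr_gt0.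
  rewrite in_itv/= => /andP[x0 xt].
  exists (Num.truncn (t / x)) => //; rewrite /F/= in_itv/= xt andbT.
  rewrite ler_pdivrMr// mulrC -ler_pdivrMr//.
  apply: ltW; apply: (lt_trans (truncnS_gt _)); first by rewrite ltr_nat.
have mF i : measurable (F i) by exact: measurable_itv.
have ndF : nondecreasing_seq F.
  apply/nondecreasing_seqP => i; rewrite subsetEset => x; rewrite /F/= !in_itv/=.
  move=> /andP[+ ->]; rewrite andbT; apply: le_trans.
  by rewrite ler_pM2l// lef_pV2 ?posrE// ler_nat.
have /cvg_lim <- // := @ge0_nondecreasing_set_cvg_integral _ (measurableTypeR R) R F
  (fun s => (s `^ (a - 1))%:E) mu ndF mF
  (fun i => measurable_funTS ((measurable_EFinP _ _).2 (measurable_powR (a - 1))))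
  (fun i x _ => powR_ge0 _ _).
apply/cvg_lim => //.
under eq_fun.
  move=> i; rewrite integral_powR_away0//; last 2 first.
  - by rewrite divr_gt0.
  - by rewrite ltr_pdivrMr// ltr_pMr// ltr1n.
  over.
apply: cvg_EFin; first by apply: nearW.
rewrite -[X in _ --> X]subr0; apply: cvgB; first exact: cvg_cst.
rewrite -(mul0r a^-1); apply: cvgMl.
have /cvg_at_rightP := powR_cvg0 a0.
apply; split; first by move=> n; rewrite divr_gt0.
rewrite -(mulr0 t); apply: cvgMr.
have := @cvg_harmonic R; rewrite -(cvg_shiftS); exact.
Qed.

End gamma_function.

Definition image_measure d d' (T1 : measurableType d) (T2 : measurableType d')
    (R : realType) (m : {measure set T1 -> \bar R}) (f : T1 -> T2)
    (mf : measurable_fun [set: T1] f) : {measure set T2 -> \bar R} :=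
  measure_function_pushforward__canonical__measure_function_Measure m mf.

Section gamma_beta.
Context {R : realType}.
Local Notation mu := (@lebesgue_measure R).
Implicit Types a b c t x : R.

Lemma measurable_gamma_integrand a :
  measurable_fun [set: R] (fun x => x `^ (a - 1) * expR (- x)).
Proof.
apply: measurable_funM; first exact: measurable_powR.
by apply: measurableT_comp; [exact: measurable_expR|exact: oppr_measurable].
Qed.

(** Half of the exponential absorbs the power: with N = n + 1 and y = x / (2N), the inequality 1 + y
    <= exp y raised to the N-th power gives x^N <= (2N)^N exp(x/2). *)
Lemma gamma_integrand_tail a (n : nat) x : a <= n.+1%:R -> 1 <= x ->
  x `^ (a - 1) * expR (- x) <= (2 * n.+1%:R) ^+ n.+1 * expR (- 2^-1 * x).
Proof.
move=> an x1; have x0 : 0 <= x by exact: le_trans x1.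
have -> : expR (- x) = expR (- 2^-1 * x) * expR (- 2^-1 * x).
  by rewrite -expRD; congr expR; field.
rewrite mulrA ler_pM2r ?expR_gt0// -ler_pdivlMr ?expR_gt0// -expRN.
apply: (@le_trans _ _ (x ^+ n.+1)).
  by rewrite -powR_mulrn// ler_powR// (le_trans _ an)// gerBl.
have n0 : 0 < 2 * n.+1%:R :> R by rewrite mulr_gt0.
have -> : x ^+ n.+1 = (2 * n.+1%:R) ^+ n.+1 * (x / (2 * n.+1%:R)) ^+ n.+1.
  by rewrite -exprMn mulrC divfK// gt_eqF.
rewrite ler_pM2l ?exprn_gt0//.
have -> : - (- 2^-1 * x) = n.+1%:R * (x / (2 * n.+1%:R)).
  by field; rewrite nat1r.
rewrite expRM_natl lerXn2r ?nnegrE ?expR_ge0 ?divr_ge0 ?(ltW n0)//.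
by apply: le_trans (expR_ge1Dx _); rewrite lerDr.
Qed.

Lemma gamma_integral_lty a : 0 < a ->
  (\int[mu]_(x in `]0%R, +oo[) (x `^ (a - 1) * expR (- x))%:E < +oo)%E.
Proof.
move=> a0.
have mf D : measurable_fun D (fun x : R => (x `^ (a - 1) * expR (- x))%:E).
  by apply/measurable_EFinP/measurable_funTS; exact: measurable_gamma_integrand.
have f0 x : (0 <= (x `^ (a - 1) * expR (- x))%:E)%E.
  by rewrite lee_fin mulr_ge0// ?powR_ge0 ?expR_ge0.
have -> : `]0%R, +oo[%classic = `]0%R, 1%R] `|` `]1%R, +oo[ :> set R.
  apply/seteqP; split => x /=; rewrite !in_itv/= !andbT.
    by move=> ->; have [|] := leP x 1; [left|right].
  by case=> [/andP[]//|]; exact: lt_trans.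
rewrite ge0_integral_setU//=; [|exact: mf|]; last first.
  rewrite disj_set2E; apply/eqP/seteqP; split => // x /= [].
  by rewrite !in_itv/= andbT => /andP[_ /le_lt_trans] h /h; rewrite ltxx.
apply: lte_add_pinfty.
  apply: (@le_lt_trans _ _ (\int[mu]_(x in `]0%R, 1%R]) (x `^ (a - 1))%:E)%E).
    apply: ge0_le_integral => //; first exact: mf.
    - by apply/measurable_EFinP/measurable_funTS; exact: measurable_powR.
    - move=> x /=; rewrite in_itv/= => /andP[x0 _]; rewrite lee_fin ler_piMr ?powR_ge0//.
      by rewrite -expR0 ler_expR oppr_le0 ltW.
  by rewrite integral_powR// ltry.
have [n an] : exists n : nat, a <= n.+1%:R.
  by exists (Num.truncn a); rewrite ltW// truncnS_gt.
set C := (2 * n.+1%:R) ^+ n.+1 : R.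
have mE D : measurable_fun D (fun x : R => (exponential_pdf (2^-1) x)%:E).
  apply/measurable_EFinP/measurable_funTS; apply: measurable_exponential_pdf.
have h0 : 0 <= C * 2 by rewrite mulr_ge0 ?exprn_ge0.
have p0 x : 0 <= exponential_pdf (2^-1 : R) x by apply: exponential_pdf_ge0; rewrite invr_ge0.
(* The tail is compared with the exponential density of rate 1/2; the factor 2 in [C * 2] undoes its
   normalisation. *)
apply: (@le_lt_trans _ _
    (\int[mu]_(x in `]1%R, +oo[) ((C * 2)%:E * (exponential_pdf (2^-1) x)%:E))%E).
  apply: ge0_le_integral => //; first exact: mf.
  - by apply: emeasurable_funM => //; exact: mE.
  - move=> x /=; rewrite in_itv/= andbT => x1.
    rewrite -EFinM lee_fin exponential_pdfE ?(le_trans _ (ltW x1))//.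
    rewrite mulrA mulfK//.
    exact: gamma_integrand_tail (ltW x1).
rewrite ge0_integralZl//; [|exact: mE|by move=> x _; rewrite lee_fin].
rewrite lte_mul_pinfty//.
apply: (@le_lt_trans _ _ (\int[mu]_x (exponential_pdf (2^-1) x)%:E)%E).
  by apply: ge0_subset_integral => //; [exact: mE|move=> x _; rewrite lee_fin].
by rewrite integral_exponential_pdf ?invr_gt0// ltry.
Qed.

Lemma EFin_Gamma a : 0 < a ->
  (\int[mu]_(x in `]0%R, +oo[) (x `^ (a - 1) * expR (- x))%:E)%E = (Gamma a)%:E.
Proof.
move=> a0; rewrite /Gamma /Rintegral fineK// ge0_fin_numE ?gamma_integral_lty//.
by apply: integral_ge0 => x _; rewrite lee_fin mulr_ge0// ?powR_ge0 ?expR_ge0.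
Qed.

(* As [c] is arbitrary, Gamma outgrows every exponential. *)
Lemma Gamma_ge_powR a c : 0 < a -> 0 < c ->
  c `^ a * (expR (- (c + 1)) / (c + 1)) <= Gamma a.
Proof.
move=> a0 c0; rewrite -lee_fin -EFin_Gamma//.
have c10 : 0 < c + 1 by rewrite addr_gt0.
set k := _ * _.
have k0 : 0 <= k by rewrite mulr_ge0 ?powR_ge0 ?divr_ge0 ?expR_ge0 ?ltW.
apply: (@le_trans _ _ (\int[mu]_(x in `[c, (c + 1)%R]) (cst k%:E x))%E).
  by rewrite integral_cst//= lebesgue_measure_itv/= lte_fin ltrDl ltr01 -EFinB
    [c + 1]addrC addrK mule1.
have mf D : measurable_fun D (fun x : R => (x `^ (a - 1) * expR (- x))%:E).
  by apply/measurable_EFinP/measurable_funTS; exact: measurable_gamma_integrand.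
have f0 x : (0 <= (x `^ (a - 1) * expR (- x))%:E)%E.
  by rewrite lee_fin mulr_ge0// ?powR_ge0 ?expR_ge0.
apply: (@le_trans _ _
  (\int[mu]_(x in `[c, (c + 1)%R]) (x `^ (a - 1) * expR (- x))%:E)%E).
  apply: ge0_le_integral => //; first exact: mf.
  move=> x /=; rewrite in_itv/= => /andP[cx xc].
  have x0 : 0 < x by exact: lt_le_trans cx.
  (* Each of the factors 1/x, x^a and exp(-x) is monotone, so the lower bound on [c, c + 1] does not
     depend on the sign of a - 1. *)
  have -> : x `^ (a - 1) = x^-1 * x `^ a.
    by rewrite powRB ?(gt_eqF x0) ?implybT// powRr1 ?(ltW x0)// mulrC.
  rewrite lee_fin /k [X in X <= _](_ : _ = (c + 1)^-1 * (expR (- (c + 1)) * c `^ a)); last by ring.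
  rewrite [X in _ <= X](_ : _ = x^-1 * (expR (- x) * x `^ a)); last by ring.
  apply: ler_pM; rewrite ?invr_ge0 ?mulr_ge0 ?powR_ge0 ?expR_ge0 ?(ltW c10)//.
    by rewrite lef_pV2 ?posrE.
  apply: ler_pM; rewrite ?powR_ge0 ?expR_ge0 ?ler_expR ?lerN2//.
  by rewrite ge0_ler_powR ?nnegrE ?(ltW a0) ?(ltW c0) ?(ltW x0).
apply: ge0_subset_integral => //; first exact: mf.
by move=> x /=; rewrite !in_itv/= andbT => /andP[+ _]; exact: lt_le_trans.
Qed.

Lemma Gamma_gt0 a : 0 < a -> 0 < Gamma a.
Proof.
move=> a0; apply: lt_le_trans (Gamma_ge_powR a0 ltr01).
by rewrite powR1 mul1r divr_gt0 ?expR_gt0.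
Qed.

Lemma Gamma1 : Gamma 1 = 1 :> R.
Proof.
apply: EFin_inj; rewrite -EFin_Gamma//.
rewrite -(integral_exponential_pdf (@ltr01 R)) integral_mkcond.
rewrite -integral_mkcond integral_itv_obnd_cbnd; last first.
  by apply/measurable_EFinP/measurable_funTS; exact: measurable_gamma_integrand.
rewrite [LHS]integral_mkcond; apply: eq_integral => x _.
rewrite /exponential_pdf !patchE; case: ifPn => // _.
by rewrite subrr powRr0 !mul1r mulN1r.
Qed.

(** By uniqueness of Lebesgue measure: [c] times the image of [mu] under the affine map gives every
    half-open interval its length. Scaling and translation are both instances. *)
Lemma ge0_integral_affine (f : R -> \bar R) c b : 0 < c ->
  measurable_fun [set: R] f -> (forall x, 0 <= f x)%E ->
  (\int[mu]_x f x = c%:E * \int[mu]_x f (c * x + b)%R)%E.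
Proof.
move=> c0 mf f0.
have mphi : measurable_fun [set: measurableTypeR R]
    ((fun x => c * x + b) : _ -> measurableTypeR R).
  by apply: measurable_funD => //; exact: measurable_funM.
pose m := mscale (NngNum (ltW c0)) (image_measure mu mphi).
transitivity (\int[m]_x f x)%E.
  apply: eq_measure_integral => A mA _; apply: lebesgue_measure_unique => //.
  move=> _ [[u v]] _ <-.
  transitivity (c%:E * mu `]((u - b) / c)%R, ((v - b) / c)%R]%classic)%E; last first.
    congr (c%:E * mu _)%E.
    apply/seteqP; split => x /=; rewrite !in_itv/= ltr_pdivrMr// ler_pdivlMr//;
      by rewrite ltrBlDr lerBrDr mulrC.
  rewrite !lebesgue_measure_itv/= !lte_fin ltr_pM2r ?invr_gt0// ltrD2r.
  case: ifPn => _; last by rewrite mule0.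
  by rewrite -!EFinB -EFinM; congr EFin; field; rewrite gt_eqF.
rewrite ge0_integral_mscale//=; congr (_ * _)%E.
rewrite ge0_integral_pushforward//; exact: mf.
Qed.

End gamma_beta.

(** * The beta integral, from homogeneity of convolutions of powers and Tonelli's theorem *)

Section beta_integral.
Context {R : realType}.
Local Notation mu := (@lebesgue_measure R).
Implicit Types a b c t x z : R.

(** Cutting the power off at 0 turns the convolution on ]0, z[ into an integral over the whole line,
    where Tonelli, translation and scaling apply without tracking domains. *)
Definition pos_powR a x : R := if 0 < x then x `^ (a - 1) else 0.

Lemma pos_powR_ge0 a x : 0 <= pos_powR a x.
Proof. by rewrite /pos_powR; case: ifPn => // _; exact: powR_ge0. Qed.

Lemma pos_powRZ a c x : 0 < c -> pos_powR a (c * x) = c `^ (a - 1) * pos_powR a x.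
Proof.
move=> c0; rewrite /pos_powR pmulr_rgt0//; case: ifPn; rewrite ?mulr0// => x0.
by rewrite powRM// ltW.
Qed.

Lemma measurable_pos_powR a : measurable_fun [set: R] (pos_powR a).
Proof.
apply: measurable_fun_ifT; [exact: measurable_fun_ltr|exact: measurable_powR|].
exact: measurable_cst.
Qed.

Lemma integral_pos_powR_exp a : 0 < a ->
  (\int[mu]_x (pos_powR a x * expR (- x))%:E = (Gamma a)%:E)%E.
Proof.
move=> a0; rewrite -EFin_Gamma// [RHS]integral_mkcond; apply: eq_integral => x _.
rewrite patchE /pos_powR mem_setE in_itv/= andbT.
by case: ifPn; rewrite ?mul0r.
Qed.

Let conv a b z := (\int[mu]_x (pos_powR a x * pos_powR b (z - x))%:E)%E.

Let measurable_conv2 a b :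
  measurable_fun [set: R * R] (fun p => pos_powR a p.2 * pos_powR b (p.1 - p.2)).
Proof.
apply: measurable_funM.
  exact: measurableT_comp (measurable_pos_powR a) measurable_snd.
apply: (measurableT_comp (measurable_pos_powR b)).
by apply: measurable_funB; [exact: measurable_fst|exact: measurable_snd].
Qed.

Let conv_ge0 a b z x : (0 <= (pos_powR a x * pos_powR b (z - x))%:E)%E.
Proof. by rewrite lee_fin mulr_ge0 ?pos_powR_ge0. Qed.

Let measurable_conv a b z :
  measurable_fun [set: R] (fun x => (pos_powR a x * pos_powR b (z - x))%:E).
Proof.
apply/measurable_EFinP; apply: measurable_funM; first exact: measurable_pos_powR.
apply: measurableT_comp; first exact: measurable_pos_powR.
exact: measurable_funB.
Qed.

(** The substitution x = z y pulls out z^(a-1) z^(b-1) and a Jacobian z, so the convolution is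
    determined by its value at 1, the beta constant. *)
Let conv_scale a b z : conv a b z = ((pos_powR (a + b) z)%:E * conv a b 1)%E.
Proof.
have [z0|z0] := ltP 0 z; last first.
  rewrite [in RHS]/pos_powR ltNge z0 mul0e.
  apply: integral0_eq => x _; rewrite /pos_powR subr_gt0.
  by do 2!case: ifPn; rewrite ?mulr0 ?mul0r// => /lt_le_trans/(_ z0)/lt_trans h /h; rewrite ltxx.
rewrite /conv (ge0_integral_affine 0 z0)//.
have -> : (\int[mu]_x (pos_powR a (z * x + 0) * pos_powR b (z - (z * x + 0)))%:E =
  \int[mu]_x ((z `^ (a - 1) * z `^ (b - 1))%:E * (pos_powR a x * pos_powR b (1 - x))%:E))%E.
  apply: eq_integral => x _; rewrite -EFinM addr0.
  rewrite -[X in X - z * x]mulr1 -mulrBr !pos_powRZ//; congr EFin; ring.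
rewrite ge0_integralZl//; [|exact: measurable_conv|by rewrite lee_fin mulr_ge0 ?powR_ge0].
rewrite muleA -EFinM; congr (_%:E * _)%E.
rewrite /pos_powR z0 -{1}(powRr1 (ltW z0)) -!powRD ?(gt_eqF z0) ?implybT//.
by congr (_ `^ _); ring.
Qed.

(** The double integral of x^(a-1) (z-x)^(b-1) exp(-z) is computed in both orders. Integrating over
    x first gives, by homogeneity, the beta constant times Gamma(a+b); integrating over z first,
    after a translation by x, gives Gamma(a) Gamma(b). *)
Lemma beta_integral1 a b : 0 < a -> 0 < b ->
  (\int[mu]_x (pos_powR a x * pos_powR b (1 - x))%:E =
   (Gamma a * Gamma b / Gamma (a + b))%:E)%E.
Proof.
move=> a0 b0; rewrite -/(conv a b 1).
have ab0 : 0 < a + b by rewrite addr_gt0.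
suff : (conv a b 1 * (Gamma (a + b))%:E = (Gamma a * Gamma b)%:E)%E.
  move=> h; rewrite EFinM -h -muleA -EFinM divff ?mule1//.
  by rewrite gt_eqF// Gamma_gt0.
have mexp : measurable_fun [set: R] (fun x : R => expR (- x)).
  by apply: measurableT_comp; [exact: measurable_expR|exact: oppr_measurable].
have mE c : measurable_fun [set: R] (fun x => (pos_powR c x * expR (- x))%:E).
  by apply/measurable_EFinP; apply: measurable_funM => //; exact: measurable_pos_powR.
have E0 c x : (0 <= (pos_powR c x * expR (- x))%:E)%E.
  by rewrite lee_fin mulr_ge0 ?pos_powR_ge0 ?expR_ge0.
have := @fubini_tonelli _ _ _ _ _ mu mu
  (fun p => (pos_powR a p.2 * pos_powR b (p.1 - p.2) * expR (- p.1))%:E).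
have H : measurable_fun [set: R * R] (fun p : R * R =>
   (pos_powR a p.2 * pos_powR b (p.1 - p.2) * expR (- p.1))%:E).
  apply/measurable_EFinP; apply: measurable_funM => //.
  exact: measurableT_comp mexp measurable_fst.
move=> /(_ H); have K (x : R * R) : (0 <= (pos_powR a x.2 * pos_powR b (x.1 - x.2) * expR (- x.1))%:E)%E.
  by rewrite lee_fin !mulr_ge0 ?pos_powR_ge0 ?expR_ge0.
move=> /(_ K) /=.
have -> : (\int[mu]_x \int[mu]_y
    (pos_powR a y * pos_powR b (x - y) * expR (- x))%:E =
    \int[mu]_x (conv a b 1 * (pos_powR (a + b) x * expR (- x))%:E))%E.
  apply: eq_integral => x _.
  under eq_integral do rewrite mulrC EFinM.
  rewrite ge0_integralZl//; [|exact: measurable_conv].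
  by rewrite -/(conv a b x) conv_scale muleC muleAC -EFinM muleC.
rewrite ge0_integralZl//; [|exact: mE|by apply: integral_ge0].
rewrite integral_pos_powR_exp// => ->.
rewrite EFinM -[in RHS](integral_pos_powR_exp a0) muleC.
rewrite -ge0_integralZl//; [|exact: mE|by rewrite lee_fin ltW// Gamma_gt0].
apply: eq_integral => y _.
have -> : (\int[mu]_x (pos_powR a y * pos_powR b (x - y) * expR (- x))%:E =
  \int[mu]_x ((pos_powR a y * expR (- y))%:E * (pos_powR b (1 * x + - y) * expR (- (1 * x + - y)))%:E))%E.
  apply: eq_integral => x _; rewrite -EFinM mul1r; congr EFin.
  have -> : expR (- x) = expR (- y) * expR (- (x - y)).
    by rewrite -expRD; congr expR; ring.
  ring.
rewrite ge0_integralZl//; last first.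
  apply/measurable_EFinP; apply: measurable_funM.
    by apply: measurableT_comp; [exact: measurable_pos_powR|exact: measurable_funD].
  by apply: (measurableT_comp mexp); exact: measurable_funD.
rewrite muleC; congr (_ * _)%E.
rewrite -[RHS](integral_pos_powR_exp b0).
by rewrite (ge0_integral_affine (- y) (@ltr01 R) (mE b) (E0 b)) mul1e.
Qed.

Lemma beta_integral a b z : 0 < a -> 0 < b -> 0 < z ->
  (\int[mu]_(x in `]0%R, z[) (x `^ (a - 1) * (z - x) `^ (b - 1))%:E =
   (z `^ (a + b - 1) * (Gamma a * Gamma b / Gamma (a + b)))%:E)%E.
Proof.
move=> a0 b0 z0.
transitivity (conv a b z).
  rewrite integral_mkcond; apply: eq_integral => x _.
  rewrite patchE /pos_powR mem_setE in_itv/= subr_gt0.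
  by case: (0 < x); case: (x < z); rewrite ?mulr0 ?mul0r.
by rewrite conv_scale /conv beta_integral1// /pos_powR z0 -EFinM.
Qed.

End beta_integral.

(** * The Mittag-Leffler density and its convolutions *)

Section mittag_leffler_series.
Context {R : realType}.
Implicit Types a b x y : R.

Lemma mittag_leffler_term_le a b y : 0 < a -> 0 < b -> 0 <= y ->
  exists2 C, 0 <= C & forall (r : nat) x, `|x| <= y ->
    `|x ^+ r / Gamma (a * r%:R + b)| <= C * 2^-1 ^+ r.
Proof.
move=> a0 b0 y0.
have y1 : 0 < 2 * y + 1 by rewrite ltr_pwDr// mulr_ge0.
(* With this [c] the bound [Gamma_ge_powR] contains c^(a r) = (2y+1)^r, and y / (2y+1) <= 1/2 gives
   the geometric rate. The summand 1 keeps [c] positive when y = 0. *)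
pose c := (2 * y + 1) `^ a^-1.
have c0 : 0 < c by rewrite powR_gt0.
have k0 : 0 < c `^ b * (expR (- (c + 1)) / (c + 1)).
  apply: mulr_gt0; first exact: powR_gt0.
  by apply: divr_gt0; [exact: expR_gt0|exact: addr_gt0].
exists (c `^ b * (expR (- (c + 1)) / (c + 1)))^-1; first by rewrite invr_ge0 ltW.
move=> r x xy.
have s0 : 0 < a * r%:R + b by rewrite ltr_wpDl// mulr_ge0// ltW.
rewrite normrM normrX normfV (gtr0_norm (Gamma_gt0 s0)) ler_pdivrMr ?Gamma_gt0//.
have /(ler_wpM2l _) := Gamma_ge_powR s0 c0.
have -> : c `^ (a * r%:R + b) = (2 * y + 1) ^+ r * c `^ b.
  rewrite powRD ?(gt_eqF c0) ?implybT//; congr (_ * _).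
  by rewrite powRrM /c -[(_ `^ a^-1) `^ a]powRrM mulVf ?gt_eqF// powRr1 ?(ltW y1)// powR_mulrn// ltW.
move=> H.
apply: le_trans (H ((c `^ b * (expR (- (c + 1)) / (c + 1)))^-1 * 2^-1 ^+ r) _); last first.
  by rewrite mulr_ge0 ?invr_ge0 ?ltW// exprn_gt0.
rewrite [leRHS](_ : _ = ((c `^ b * (expR (- (c + 1)) / (c + 1)))^-1 *
   (c `^ b * (expR (- (c + 1)) / (c + 1)))) * (2^-1 * (2 * y + 1)) ^+ r); last first.
  by rewrite exprMn; ring.
rewrite mulVf ?gt_eqF// mul1r lerXn2r ?nnegrE//.
  by rewrite mulr_ge0 ?invr_ge0 ?(ltW y1).
by apply: le_trans xy _; rewrite mulrDr mulrA mulVf// mul1r lerDl mulr1 invr_ge0.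
Qed.

Lemma mittag_leffler_series_le a b y : 0 < a -> 0 < b -> 0 <= y ->
  exists2 C, 0 <= C & forall (n : nat) x, `|x| <= y ->
    `|series (fun r : nat => x ^+ r / Gamma (a * r%:R + b)) n| <= C.
Proof.
move=> a0 b0 y0; have [C C0 HC] := mittag_leffler_term_le a0 b0 y0.
exists (C * 2); first by rewrite mulr_ge0.
move=> n x xy; rewrite /series/= (le_trans (ler_norm_sum _ _ _))//.
apply: (@le_trans _ _ (\sum_(0 <= i < n) C * 2^-1 ^+ i)).
  by apply: ler_sum => i _; exact: HC.
rewrite -mulr_sumr ler_wpM2l//.
have -> : \sum_(0 <= i < n) 2^-1 ^+ i = 2 - 2 * 2^-1 ^+ n :> R.
  elim: n => [|n IH]; first by rewrite big_geq// expr0; ring.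
  by rewrite big_nat_recr//= IH exprS; field.
by rewrite lerBlDr lerDl mulr_ge0// exprn_ge0// invr_ge0.
Qed.

Lemma mittag_leffler_cvg a b x : 0 < a -> 0 < b ->
  series (fun r : nat => x ^+ r / Gamma (a * r%:R + b)) @ \oo --> mittag_leffler a b x.
Proof.
move=> a0 b0; have [C C0 HC] := mittag_leffler_term_le a0 b0 (normr_ge0 x).
suff : cvg (series (fun r : nat => x ^+ r / Gamma (a * r%:R + b)) @ \oo) by [].
apply: normed_cvg; apply: (@series_le_cvg _ _ (fun r => C * 2^-1 ^+ r)).
- by move=> n /=.
- by move=> n; rewrite mulr_ge0// exprn_ge0// invr_ge0.
- by move=> n; exact: HC.
- by apply: is_cvg_geometric_series; rewrite ger0_norm ?invr_ge0// invf_lt1// ltr1n.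
Qed.

End mittag_leffler_series.

(** * Convolution of the interarrival density with fractional powers *)

Section mittag_leffler_density.
Context {R : realType} (nu L : R).
Hypotheses (nu0 : 0 < nu) (L0 : 0 < L).
Local Notation mu := (@lebesgue_measure R).

Definition ml_density x : R := L * x `^ (nu - 1) * mittag_leffler nu nu (- L * x `^ nu).

(** This is the Riemann-Liouville fractional integral of order [nu * m] of the constant 1. *)
Definition frac_power m u : R := u `^ (nu * m%:R) / Gamma (nu * m%:R + 1).

Let density_partial n x : R :=
  L * x `^ (nu - 1) * series (fun r : nat => (- L * x `^ nu) ^+ r / Gamma (nu * r%:R + nu)) n.

Lemma nuS_gt0 m : 0 < nu * m%:R + 1.
Proof. by rewrite ltr_wpDl// mulr_ge0// ltW. Qed.

Lemma frac_power_ge0 m u : 0 <= frac_power m u.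
Proof. by rewrite divr_ge0 ?powR_ge0 ?ltW ?Gamma_gt0 ?nuS_gt0. Qed.

Lemma le_frac_power m u v : 0 <= u -> u <= v -> frac_power m u <= frac_power m v.
Proof.
move=> u0 uv; rewrite ler_pM2r ?invr_gt0 ?Gamma_gt0 ?nuS_gt0//.
by rewrite ge0_ler_powR ?nnegrE ?mulr_ge0 ?(ltW nu0)// (le_trans u0).
Qed.

Lemma frac_power0 u : frac_power 0 u = 1.
Proof. by rewrite /frac_power mulr0 powRr0 add0r Gamma1 divr1. Qed.

Lemma measurable_frac_power m : measurable_fun [set: R] (frac_power m).
Proof. by apply: measurable_funM => //; exact: measurable_powR. Qed.

Let density_partial_cvg x : density_partial ^~ x @ \oo --> ml_density x.
Proof. by apply: cvgMr; exact: mittag_leffler_cvg. Qed.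

Let measurable_density_partial n : measurable_fun [set: R] (density_partial n).
Proof.
apply: measurable_funM; first by apply: measurable_funM => //; exact: measurable_powR.
apply: measurable_sum => i; apply: measurable_funM => //.
apply: measurable_funX; apply: measurable_funM => //; exact: measurable_powR.
Qed.

Lemma measurable_ml_density : measurable_fun [set: R] ml_density.
Proof.
exact: (@measurable_fun_cvg _ _ _ _ density_partial).
Qed.

Let density_partial_le t : 0 < t -> exists2 C, 0 <= C &
  forall n x, 0 < x -> x <= t -> `|density_partial n x| <= C * x `^ (nu - 1).
Proof.
move=> t0; have y0 : 0 <= L * t `^ nu by rewrite mulr_ge0 ?powR_ge0 ?ltW.
have [C C0 HC] := mittag_leffler_series_le nu0 nu0 y0.
exists (L * C); first by rewrite mulr_ge0 ?(ltW L0).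
move=> n x x0 xt; rewrite /density_partial normrM (ger0_norm (mulr_ge0 (ltW L0) (powR_ge0 _ _))).
rewrite [leRHS]mulrAC; apply: ler_wpM2l; first by rewrite mulr_ge0 ?powR_ge0 ?(ltW L0).
apply: HC; rewrite normrM normrN !ger0_norm ?powR_ge0 ?(ltW L0)//.
rewrite ler_wpM2l ?(ltW L0)//.
by rewrite ge0_ler_powR ?nnegrE ?(ltW nu0) ?(ltW x0) ?(ltW t0).
Qed.

Let conv_term m r t : 0 < t ->
  (\int[mu]_(s in `]0%R, t[) ((t - s) `^ (nu * m%:R) * s `^ (nu * r.+1%:R - 1))%:E =
   (t `^ (nu * (m + r.+1)%:R) * (Gamma (nu * m%:R + 1) * Gamma (nu * r.+1%:R) /
      Gamma (nu * (m + r.+1)%:R + 1)))%:E)%E.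
Proof.
move=> t0; have r0 : 0 < nu * r.+1%:R by rewrite mulr_gt0.
have E : nu * r.+1%:R + (nu * m%:R + 1) = nu * (m + r.+1)%:R + 1.
  by rewrite natrD; ring.
have := beta_integral r0 (nuS_gt0 m) t0; rewrite E addrK addrK.
rewrite [Gamma (nu * r.+1%:R) * _]mulrC => <-.
by apply: eq_integral => s _; rewrite mulrC.
Qed.

Let conv_partial m n t : 0 < t ->
  (\int[mu]_(s in `]0%R, t[) (frac_power m (t - s) * density_partial n s)%:E =
   (\sum_(0 <= r < n) (-1) ^+ r * L ^+ r.+1 * frac_power (m + r.+1) t)%:E)%E.
Proof.
move=> t0.
have mterm r : measurable_fun [set: R]
    (fun s : R => (t - s) `^ (nu * m%:R) * s `^ (nu * r.+1%:R - 1)).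
  apply: measurable_funM; last exact: measurable_powR.
  apply: (measurableT_comp (measurable_powR (nu * m%:R))).
  exact: measurable_funB.
(* The two Gamma factors in the denominator cancel those that the beta integral puts in the
   numerator, leaving exactly the normalisation of [frac_power (m + r.+1)]. *)
pose k r := (-1) ^+ r * L ^+ r.+1 / (Gamma (nu * m%:R + 1) * Gamma (nu * r.+1%:R)).
transitivity (\int[mu]_(s in `]0%R, t[) (\sum_(0 <= r < n)
    ((k r)%:E * ((t - s) `^ (nu * m%:R) * s `^ (nu * r.+1%:R - 1))%:E)))%E.
  apply: eq_integral => s; rewrite inE/= in_itv/= => /andP[s0 st].
  under [RHS]eq_bigr do rewrite -EFinM.
  rewrite sumEFin; congr EFin.
  rewrite /density_partial /series/= mulr_sumr mulr_sumr; apply: eq_bigr => r _.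
  have -> : s `^ (nu * r.+1%:R - 1) = s `^ (nu - 1) * (s `^ nu) ^+ r.
    rewrite -powR_mulrn ?powR_ge0// -powRrM -powRD ?(gt_eqF s0) ?implybT//.
    by congr (_ `^ _); rewrite -natr1; ring.
  rewrite /frac_power /k exprMn (exprNn L) exprS.
  rewrite (_ : nu * r%:R + nu = nu * r.+1%:R); last by rewrite -natr1; ring.
  rewrite invfM; ring.
have int_term r : mu.-integrable `]0%R, t[
    (fun s => ((k r)%:E * ((t - s) `^ (nu * m%:R) * s `^ (nu * r.+1%:R - 1))%:E)%E).
  apply: integrableZl => //; apply/integrableP; split.
    by apply/measurable_EFinP/measurable_funTS; exact: mterm.
  under eq_integral do rewrite gee0_abs ?lee_fin ?mulr_ge0 ?powR_ge0//.
  by rewrite conv_term// ltry.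
rewrite integral_sum//.
rewrite -sumEFin; apply: eq_bigr => r _.
rewrite integralZl//; last first.
  apply/integrableP; split; first by apply/measurable_EFinP/measurable_funTS; exact: mterm.
  under eq_integral do rewrite gee0_abs ?lee_fin ?mulr_ge0 ?powR_ge0//.
  by rewrite conv_term// ltry.
rewrite conv_term// -EFinM; congr EFin; rewrite /k /frac_power.
have G1 := Gamma_gt0 (nuS_gt0 m); have G2 := Gamma_gt0 (mulr_gt0 nu0 (ltr0Sn R r)).
by field; rewrite !gt_eqF// Gamma_gt0// nuS_gt0.
Qed.

Let density_conv m t : 0 < t ->
  mu.-integrable `]0%R, t[ (fun s => (frac_power m (t - s) * ml_density s)%:E) /\
  (fun n => \sum_(0 <= r < n) (-1) ^+ r * L ^+ r.+1 * frac_power (m + r.+1) t)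
    @ \oo --> \int[mu]_(s in `]0%R, t[) (frac_power m (t - s) * ml_density s).
Proof.
move=> t0; have [C C0 HC] := density_partial_le t0.
have mg : measurable_fun [set: R] (fun s => frac_power m (t - s)).
  apply: (measurableT_comp (measurable_frac_power m)).
  exact: measurable_funB.
have := @dominated_convergence _ (measurableTypeR R) R mu `]0%R, t[%classic
  (measurable_itv _)
  (fun n s => (frac_power m (t - s) * density_partial n s)%:E)
  (fun s => (frac_power m (t - s) * ml_density s)%:E)
  (fun s => ((frac_power m t * C)%:E * (s `^ (nu - 1))%:E)%E).
case.
- move=> n; apply/measurable_EFinP/measurable_funTS.
  exact: measurable_funM mg (measurable_density_partial n).
- apply/measurable_EFinP/measurable_funTS.
  exact: measurable_funM mg measurable_ml_density.
- apply: aeW => s _; apply: cvg_EFin; first by apply: nearW.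
  by apply: cvgMr; exact: density_partial_cvg.
- apply: integrableZl => //; apply/integrableP; split.
    by apply/measurable_EFinP/measurable_funTS; exact: measurable_powR.
  under eq_integral do rewrite gee0_abs ?lee_fin ?powR_ge0//.
  rewrite integral_itv_bndo_bndc; last first.
    by apply/measurable_EFinP/measurable_funTS; exact: measurable_powR.
  by rewrite integral_powR// ltry.
- apply: aeW => s n /=; rewrite in_itv/= => /andP[s0 st].
  rewrite lee_fin normrM (ger0_norm (frac_power_ge0 _ _)) -[leRHS]mulrA.
  apply: ler_pM => //; first exact: frac_power_ge0.
    by apply: le_frac_power; rewrite ?subr_ge0 ?(ltW st)// gerBl ltW.
  by apply: HC => //; exact: ltW.
move=> intf _ cvgf; split => //.
suff : (fun n => (\sum_(0 <= r < n) (-1) ^+ r * L ^+ r.+1 * frac_power (m + r.+1) t)%:E)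
    @ \oo --> (\int[mu]_(s in `]0%R, t[) (frac_power m (t - s) * ml_density s))%:E.
  by move=> /fine_cvgP[].
rewrite /Rintegral fineK; last exact: integrable_fin_num.
by apply: cvg_trans cvgf; apply: near_eq_cvg; apply: nearW => n /=; rewrite conv_partial.
Qed.

Definition density_conv_power m t : R :=
  \int[mu]_(s in `]0%R, t[) (frac_power m (t - s) * ml_density s).

(* The density is the alternating series of the kernels [s^(nu r - 1)], and convolution
   with each of them shifts the index of [frac_power]; splitting off its first term gives
   the recurrence. *)
Lemma density_conv_powerS m t : 0 < t ->
  density_conv_power m t = L * (frac_power m.+1 t - density_conv_power m.+1 t).
Proof.
move=> t0; have cm1 := (density_conv m.+1 t0).2.
have := (density_conv m t0).2; rewrite -cvg_shiftS => /(cvg_lim (@Rhausdorff R)).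
rewrite -/(density_conv_power m t) => <-; apply/cvg_lim; first exact: Rhausdorff.
rewrite [X in X @ _ --> _](_ : _ = fun n => L * (frac_power m.+1 t -
  \sum_(0 <= r < n) (-1) ^+ r * L ^+ r.+1 * frac_power (m.+1 + r.+1) t)); last first.
  apply/funext => n /=; rewrite big_nat_recl//= expr0 expr1 mul1r addn1 mulrBr; congr (_ + _).
  rewrite mulr_sumr -sumrN; apply: eq_bigr => r _.
  by rewrite addnS -addSn !exprS; ring.
by apply: cvgMr; apply: cvgB => //; exact: cvg_cst.
Qed.

Section law.
Variable law : probability (measurableTypeR R) R.
Hypothesis lawE : forall A : set R, measurable A ->
  law A = (\int[mu]_(x in A `&` `]0%R, +oo[) (ml_density x)%:E)%E.

Let law_dominated : law `<< mu.
Proof.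
apply/null_content_dominatesP => A mA A0; rewrite lawE//; apply: null_set_integral.
- by apply: measurableI.
- by apply/measurable_EFinP/measurable_funTS; exact: measurable_ml_density.
- by apply: (subset_measure0 _ _ _ A0) => //; exact: measurableI.
Qed.

(* [ml_density] is not known to be nonnegative here, so the Radon-Nikodym derivative, which
   has the same integrals, stands in for it. *)
Lemma integral_law (g : R -> R) t : 0 < t -> measurable_fun [set: R] g ->
  law.-integrable `]0%R, t[ (EFin \o g) ->
  (\int[law]_(s in `]0%R, t[) (g s)%:E = \int[mu]_(s in `]0%R, t[) (g s * ml_density s)%:E)%E.
Proof.
move=> t0 mg ig.
rewrite -(Radon_Nikodym_change_of_variables law_dominated _ ig)//.
apply: ae_eq_integral => //.
- apply: emeasurable_funM; first exact: measurable_int ig.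
  by apply: measurable_funTS.
- apply/measurable_EFinP/measurable_funTS.
  exact: measurable_funM mg measurable_ml_density.
under [X in ae_eq _ _ _ X]eq_fun do rewrite EFinM.
apply: ae_eqe_mul2l; apply: integral_ae_eq => //.
- by apply: (integrableS measurableT) => //; exact: Radon_Nikodym_integrable.
- by apply/measurable_EFinP/measurable_funTS; exact: measurable_ml_density.
move=> A At mA; rewrite -Radon_Nikodym_integral//= lawE//.
congr (integral _ _ _); apply/seteqP; split => x; first by case.
by move=> Ax; split => //; move: (At _ Ax); rewrite /= !in_itv/= andbT => /andP[].
Qed.

Lemma integral_law_frac_power m t : 0 < t ->
  \int[law]_(s in `]0%R, t[) frac_power m (t - s) = density_conv_power m t.
Proof.
move=> t0; have mg : measurable_fun [set: R] (fun s => frac_power m (t - s)).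
  apply: (measurableT_comp (measurable_frac_power m)).
  exact: measurable_funB.
rewrite /density_conv_power /Rintegral integral_law//.
apply: (@le_integrable _ _ _ _ _ _ _ (EFin \o cst (frac_power m t))) => //.
- by apply/measurable_EFinP/measurable_funTS.
- move=> s /=; rewrite in_itv/= => /andP[s0 st].
  rewrite lee_fin !ger0_norm ?frac_power_ge0// le_frac_power// ?subr_ge0 ?(ltW st)//.
  by rewrite gerBl ltW.
- exact: finite_measure_integrable_cst.
Qed.

End law.

End mittag_leffler_density.

(** * The renewal equation *)

Section renewal_equation.
Context {R : realType} (law : probability (measurableTypeR R) R).
Implicit Types (h : R -> R) (t u : R).

Definition law_conv h t : R := \int[law]_(s in `]0%R, t[) h (t - s).

(** The bound is required on ]0, t[ only: these are the arguments that [law_conv h t] sees, and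
    [frac_power nu m] with m > 0 is unbounded on the half-line. *)
Definition bounded_measurable t h :=
  measurable_fun [set: R] h /\ exists C, forall u, 0 < u < t -> `|h u| <= C.

Let in_reflected t s : `]0%R, t[%classic s -> 0 < t - s < t.
Proof. by rewrite /= in_itv/= => /andP[s0 st]; rewrite subr_gt0 st gtrBl. Qed.

Let integrable_conv t h : bounded_measurable t h ->
  law.-integrable `]0%R, t[ (fun s => (h (t - s))%:E).
Proof.
move=> [mh [C hC]].
apply: (@le_integrable _ _ _ _ _ _ _ (EFin \o cst C)) => //.
- apply/measurable_EFinP/measurable_funTS; apply: (measurableT_comp mh).
  exact: measurable_funB.
- move=> s /in_reflected /hC /= H; rewrite lee_fin (le_trans H)//; exact: ler_norm.
- exact: finite_measure_integrable_cst.
Qed.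

Lemma bounded_measurable_sum t n (c : nat -> R) (h : nat -> R -> R) :
  (forall i, bounded_measurable t (h i)) ->
  bounded_measurable t (fun u => \sum_(0 <= i < n) c i * h i u).
Proof.
move=> H; split.
  by apply: measurable_sum => i; apply: measurable_funM => //; exact: (H i).1.
elim: n => [|n [C HC]].
  by exists 0 => u _; rewrite big_geq// normr0.
have [D HD] := (H n).2; exists (C + `|c n| * D) => u u0.
rewrite big_nat_recr//= (le_trans (ler_normD _ _))// lerD ?HC// normrM.
by rewrite ler_wpM2l// HD.
Qed.

Lemma law_conv_sum t n (c : nat -> R) (h : nat -> R -> R) :
  (forall i, bounded_measurable t (h i)) ->
  law_conv (fun u => \sum_(0 <= i < n) c i * h i u) t =
  \sum_(0 <= i < n) c i * law_conv (h i) t.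
Proof.
move=> H; elim: n => [|n IH].
  rewrite big_geq// /law_conv (@eq_Rintegral _ _ _ _ _ (cst 0)); last first.
    by move=> s _; rewrite big_geq.
  by rewrite Rintegral_cst// mul0r.
rewrite big_nat_recr//= -IH /law_conv -RintegralZl//; last exact: integrable_conv.
rewrite -RintegralD//; last 2 first.
- exact: (integrable_conv (bounded_measurable_sum n c H)).
- rewrite [X in _.-integrable _ X](_ : _ = fun s => ((c n)%:E * (h n (t - s))%:E)%E)//.
  by apply: integrableZl => //; exact: (integrable_conv (H n)).
by apply: eq_Rintegral => s _; rewrite big_nat_recr.
Qed.

Lemma law_conv_lin t (a b : R) h1 h2 : bounded_measurable t h1 -> bounded_measurable t h2 ->
  law_conv (fun u => a * h1 u + b * h2 u) t = a * law_conv h1 t + b * law_conv h2 t.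
Proof.
move=> H1 H2; have := @law_conv_sum t 2 (fun i => if i == 0%N then a else b)
  (fun i => if i == 0%N then h1 else h2).
rewrite !big_nat_recr//= !big_geq//= !add0r => <-; last by case.
by apply: eq_Rintegral => s _; rewrite !big_nat_recr//= big_geq//= add0r.
Qed.

Lemma eq_law_conv t h1 h2 : (forall u, 0 < u < t -> h1 u = h2 u) ->
  law_conv h1 t = law_conv h2 t.
Proof. by move=> H; apply: eq_Rintegral => s; rewrite inE => /in_reflected /H. Qed.

Lemma law_conv_norm t h C : measurable_fun [set: R] h ->
  (forall u, 0 < u < t -> `|h u| <= C) -> 0 <= C -> `|law_conv h t| <= C.
Proof.
move=> mh hC C0.
have bh : bounded_measurable t h by split => //; exists C.
apply: (le_trans (le_normr_Rintegral _ _)) => //; first exact: integrable_conv.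
apply: (@le_trans _ _ (\int[law]_(s in `]0%R, t[) cst C s)).
  apply: le_Rintegral => //.
  - exact: (integrable_norm (integrable_conv bh)).
  - exact: finite_measure_integrable_cst.
  - by move=> s /in_reflected /hC.
rewrite Rintegral_cst// ler_piMr// -lee_fin fineK ?fin_num_measure//.
exact: probability_le1.
Qed.

Variables (nu L l : R) (F : nat -> R -> R).
Hypotheses (nu0 : 0 < nu) (l0 : 0 < l) (lL : l <= L).
Hypothesis law_density : forall A : set R, measurable A ->
  law A = (\int[@lebesgue_measure R]_(x in A `&` `]0%R, +oo[) (ml_density nu L x)%:E)%E.
Hypotheses (mF : forall n, measurable_fun [set: R] (F n))
  (F01 : forall n u, `|F n u| <= 1)
  (F0 : forall u, 0 < u -> F 0 u = 1)
  (FS : forall n u, 0 < u -> F n.+1 u = law_conv (F n) u).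

Local Notation p := (l / L).
Local Notation q := (1 - l / L).
Let L0 : 0 < L. Proof. exact: lt_le_trans lL. Qed.
Let p0 : 0 <= p. Proof. by rewrite divr_ge0 ?ltW. Qed.
Let q0 : 0 <= q. Proof. by rewrite subr_ge0 ler_pdivrMr// mul1r. Qed.
Let q1 : q < 1. Proof. by rewrite gtrBl divr_gt0. Qed.

Let A n u := \sum_(0 <= i < n) p * q ^+ i * F i.+1 u.
Let G n u := \sum_(0 <= m < n) (-1) ^+ m * l ^+ m.+1 * frac_power nu m.+1 u.
Let k m u := law_conv (frac_power nu m) u.

Let boundedF t n : bounded_measurable t (F n).
Proof. by split; [exact: mF|exists 1 => u _; exact: F01]. Qed.

Let bounded_frac t m : bounded_measurable t (frac_power nu m).
Proof.
split; first exact: measurable_frac_power.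
exists (frac_power nu m t) => u /andP[u0 ut].
by rewrite ger0_norm ?frac_power_ge0// le_frac_power// ltW.
Qed.

Let kS m u : 0 < u -> frac_power nu m.+1 u = k m u / L + k m.+1 u.
Proof.
move=> u0; rewrite /k /law_conv !(integral_law_frac_power nu0 law_density)//.
by rewrite (density_conv_powerS nu0 L0 m u0) mulrC mulKf ?gt_eqF// subrK.
Qed.

(** The error telescopes. By [kS] the new term of [G n.+1] has a part in [k n u / L], which cancels
    the old error, and a part in [k n.+1 u]. Splitting the latter with weights q and p, the q-share
    extends the convolution of [G] and the p-share is the new error. *)
Let GE n u : 0 < u -> G n u = p * k 0 u + q * law_conv (G n) u - p * (-1) ^+ n * l ^+ n * k n u.
Proof.
move=> u0; rewrite [law_conv _ _]law_conv_sum//.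
elim: n => [|n IH].
  by rewrite /G !big_geq// !expr0 mulr0 addr0 !mulr1 subrr.
have -> : G n.+1 u = G n u + (-1) ^+ n * l ^+ n.+1 * frac_power nu n.+1 u.
  by apply: big_nat_recr.
rewrite [X in q * X]big_nat_recr; last by [].
rewrite IH (kS n u0) -/(k n.+1 u) /=.
set S := \sum_(0 <= i < n) _; rewrite !exprS.
move: (k 0 u) (k n u) (k n.+1 u) S => k0 kn kn1 S.
by field; rewrite gt_eqF.
Qed.

Let AE n u : 0 < u -> A n.+1 u = p * k 0 u + q * law_conv (A n) u.
Proof.
move=> u0; rewrite [law_conv _ _]law_conv_sum// /A big_nat_recl//= expr0 mulr1 FS//.
congr (p * _ + _); first by apply: eq_law_conv => v /andP[v0 _]; rewrite F0// frac_power0.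
by rewrite mulr_sumr; apply: eq_bigr => i _; rewrite FS// exprS; ring.
Qed.

(* [A n - G m] is contracted by the factor [q] up to the error [p l^m k m]. *)
Let AG_le n m t u : 0 < u -> u <= t ->
  `|A n u - G m u| <= l ^+ m * frac_power nu m t +
    q ^+ n * \sum_(0 <= i < m) l ^+ i.+1 * frac_power nu i.+1 t.
Proof.
(* The point [u] must vary, since the convolution evaluates the previous step at every v < u, while
   [m] and the horizon [t] in the bound stay fixed. *)
elim: n u => [|n IH] u u0 ut.
  rewrite /A big_geq// sub0r normrN expr0 mul1r -[leLHS]add0r lerD//.
    by rewrite mulr_ge0 ?exprn_ge0 ?frac_power_ge0 ?(ltW l0).
  rewrite (le_trans (ler_norm_sum _ _ _))//; apply: ler_sum => i _.
  rewrite 2!normrM normrX normrN1 expr1n mul1r ger0_norm ?exprn_ge0 ?(ltW l0)//.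
  rewrite ler_wpM2l ?exprn_ge0 ?(ltW l0)//.
  by rewrite ger0_norm ?frac_power_ge0// le_frac_power// ltW.
have bA : bounded_measurable u (A n) by exact: bounded_measurable_sum.
have bG : bounded_measurable u (G m) by exact: bounded_measurable_sum.
set c := \sum_(0 <= i < m) _ in IH *.
have c0 : 0 <= c.
  by apply: sumr_ge0 => i _; rewrite mulr_ge0 ?exprn_ge0 ?frac_power_ge0 ?(ltW l0).
set e := l ^+ m * _ in IH *.
have e0 : 0 <= e by rewrite mulr_ge0 ?exprn_ge0 ?frac_power_ge0 ?(ltW l0).
rewrite AE// GE//.
have -> : p * k 0 u + q * law_conv (A n) u -
   (p * k 0 u + q * law_conv (G m) u - p * (-1) ^+ m * l ^+ m * k m u) =
   q * law_conv (fun v => 1 * A n v + (-1) * G m v) u + p * (-1) ^+ m * l ^+ m * k m u.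
  rewrite (law_conv_lin 1 (-1) bA bG).
  by move: (k 0 u) (k m u) (law_conv (A n) u) (law_conv (G m) u) => *; ring.
(* The bound reproduces itself: e + q^(n+1) c = q (e + q^n c) + p e. The two summands match the
   contracted difference and the error of [GE]. *)
have affine (x y z b : R) : x + (1 - b) * y * z = (1 - b) * (x + y * z) + b * x by ring.
rewrite exprS affine.
apply: (le_trans (ler_normD _ _)); apply: lerD.
  rewrite normrM ger0_norm// ler_wpM2l//; apply: law_conv_norm.
  - apply: measurable_funD; apply: measurable_funM => //; [exact: bA.1|exact: bG.1].
  - move=> v /andP[v0 vu]; rewrite mul1r mulN1r; apply: IH => //.
    by rewrite ltW// (lt_le_trans vu).
  - by rewrite addr_ge0// mulr_ge0// exprn_ge0.
rewrite 3!normrM normrX normrN1 expr1n mulr1 (ger0_norm p0).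
rewrite (ger0_norm (exprn_ge0 _ (ltW l0))).
rewrite -mulrA ler_wpM2l// ler_wpM2l ?exprn_ge0 ?(ltW l0)//.
apply: law_conv_norm; [exact: measurable_frac_power| |exact: frac_power_ge0].
move=> v /andP[v0 vu]; rewrite ger0_norm ?frac_power_ge0// le_frac_power// ltW//.
exact: lt_le_trans vu ut.
Qed.

Lemma renewal_mittag_leffler t Ft : 0 < t ->
  (fun n => \sum_(0 <= i < n) p * q ^+ i * F i.+1 t) @ \oo --> Ft ->
  Ft = l * t `^ nu * mittag_leffler nu (nu + 1) (- l * t `^ nu).
Proof.
move=> t0 AF.
have FG m : `|Ft - G m t| <= l ^+ m * frac_power nu m t.
  have h1 : (fun n => `|A n t - G m t|) @ \oo --> `|Ft - G m t|.
    by apply: cvg_norm; apply: cvgB => //; exact: cvg_cst.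
  have h2 : (fun n => l ^+ m * frac_power nu m t +
      q ^+ n * \sum_(0 <= i < m) l ^+ i.+1 * frac_power nu i.+1 t) @ \oo -->
      l ^+ m * frac_power nu m t + 0 * \sum_(0 <= i < m) l ^+ i.+1 * frac_power nu i.+1 t.
    apply: cvgD; first exact: cvg_cst.
    by apply: cvgMl; apply: cvg_expr; rewrite ger0_norm.
  rewrite mul0r addr0 in h2.
  by apply: (ler_cvg_to h1 h2); apply: nearW => n; exact: AG_le.
have x0 : 0 <= l * t `^ nu by rewrite mulr_ge0 ?powR_ge0 ?(ltW l0).
have G1 : G ^~ t @ \oo --> Ft.
  (* The remaining error l^m g_m(t) is the m-th term of E_{nu,1}(l t^nu), hence the second parameter
     1 here. *)
  have [C C0 HC] := mittag_leffler_term_le nu0 (@ltr01 R) x0.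
  apply/cvgrPdist_le => /= e e0; near=> m.
  apply: (le_trans (FG m)); apply: (@le_trans _ _ (C * 2^-1 ^+ m)).
    apply: le_trans (HC m (l * t `^ nu) _); last by rewrite ger0_norm.
    by apply: le_trans (ler_norm _); rewrite exprMn -mulrA /frac_power powRrM powR_mulrn ?powR_ge0.
  near: m.
  have : (fun m => C * (2^-1 : R) ^+ m) @ \oo --> C * 0.
    by apply: cvgMr; apply: cvg_expr; rewrite ger0_norm ?invr_ge0// invf_lt1// ltr1n.
  rewrite mulr0 => /cvgr0Pnorm_le/(_ e e0); apply: filterS => m.
  by rewrite ger0_norm// mulr_ge0// exprn_ge0// invr_ge0.
apply: (@cvg_unique _ (@Rhausdorff R) _ _ _ _ G1).
rewrite [X in X @ _](_ : _ = fun n => l * t `^ nu *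
   series (fun r : nat => (- l * t `^ nu) ^+ r / Gamma (nu * r%:R + (nu + 1))) n).
  by apply: cvgMr; apply: mittag_leffler_cvg => //; rewrite addr_gt0.
apply/funext => n; rewrite /G /series/= mulr_sumr; apply: eq_bigr => r _.
rewrite /frac_power exprMn (exprNn l) exprS.
rewrite (_ : nu * r%:R + (nu + 1) = nu * r.+1%:R + 1); last by rewrite -natr1; ring.
rewrite powRrM powR_mulrn ?powR_ge0// exprS.
by ring.
Unshelve. all: by end_near. Qed.

End renewal_equation.

(** * Paths and probabilities of the marked renewal process *)

Section independence.
Context d {T : measurableType d} {R : realType} (P : probability T R).

Definition rv_law (f : T -> R) (mf : measurable_fun [set: T] f) :
    probability (measurableTypeR R) R :=
  distribution P (HB.pack (f : T -> measurableTypeR R)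
    (isMeasurableFun.Build _ _ _ _ (f : T -> measurableTypeR R) mf) :
    {mfun T >-> measurableTypeR R}).

Lemma rv_lawE f (mf : measurable_fun [set: T] f) A : rv_law mf A = P (f @^-1` A).
Proof. by []. Qed.

Lemma measurable_preimage (f : T -> R) A : measurable_fun [set: T] f -> measurable A ->
  measurable (f @^-1` A).
Proof. by move=> mf mA; rewrite -[X in measurable X]setTI; exact: mf. Qed.

(** Conditionally on [E], the law of the pair agrees with the product law on rectangles, and hence
    everywhere by uniqueness of the product measure. A null [E] cannot be conditioned on and is
    treated apart. *)
Lemma joint_law_restr (U V : T -> R) (mU : measurable_fun [set: T] U)
    (mV : measurable_fun [set: T] V) (E : set T) : measurable E ->
  (forall A B : set R, measurable A -> measurable B ->
    P (U @^-1` A `&` (V @^-1` B `&` E)) = (P (U @^-1` A) * (P (V @^-1` B) * P E))%E) ->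
  forall C : set (measurableTypeR R * measurableTypeR R), measurable C ->
  P ((fun w => (U w, V w)) @^-1` C `&` E) = ((rv_law mU \x rv_law mV) C * P E)%E.
Proof.
move=> mE indep C mC.
have mUV : measurable_fun [set: T]
    (fun w => (U w, V w) : measurableTypeR R * measurableTypeR R).
  exact: measurable_fun_pair.
have mUVC : measurable ((fun w => (U w, V w)) @^-1` C).
  by rewrite -[X in measurable X]setTI; exact: mUV.
have [PE0|PE0] := eqVneq (P E) 0.
  rewrite PE0 mule0; apply: (subset_measure0 _ mE _ PE0) => //.
  exact: measurableI.
have PEfin : P E \is a fin_num by exact: fin_num_measure.
have e0 : 0 < fine (P E) by rewrite fine_gt0// lt0e PE0 measure_ge0 -ge0_fin_numE.
pose m := mscale (NngNum (ltW (eqbRL (invr_gt0 _) e0))) (image_measure (mrestr P mE) mUV).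
rewrite (@product_measure_unique _ _ _ _ _ (rv_law mU) (rv_law mV) m)//; last first.
  move=> A B mA mB.
  transitivity ((fine (P E))^-1%:E * P ((fun w => (U w, V w)) @^-1` (A `*` B) `&` E))%E => //.
  rewrite (_ : _ `&` E = U @^-1` A `&` (V @^-1` B `&` E)); last first.
    by rewrite setIA.
  rewrite indep// -{2}(fineK PEfin) muleCA [(P (V @^-1` B) * _)%E]muleC [X in (_ * X)%E]muleA.
  by rewrite -EFinM mulVf ?gt_eqF// mul1e.
transitivity ((fine (P E))^-1%:E * P ((fun w => (U w, V w)) @^-1` C `&` E) * P E)%E => //.
by rewrite -{2}(fineK PEfin) muleAC -EFinM mulVf ?gt_eqF// mul1e.
Qed.

End independence.

(** * Pathwise description of the first hitting time *)

Section first_hit_paths.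
Context {T : Type} {R : realType}.
Variables (J X : nat -> T -> R) (j : nat).
Implicit Types (n m : nat) (s t : R) (w : T).

Definition mark_count n w : nat := \sum_(i < n) (X i w == j%:R : nat).

Definition first_mark n w := X n w = j%:R /\ forall i, (i < n)%N -> X i w <> j%:R.

Lemma mark_countS n w : mark_count n.+1 w = (mark_count n w + (X n w == j%:R))%N.
Proof. by rewrite /mark_count big_ord_recr. Qed.

Lemma mark_count_first n w : first_mark n w -> mark_count n.+1 w = 1%N.
Proof.
move=> [Xn Xlt]; rewrite mark_countS Xn eqxx /mark_count big1// => i _.
by case: eqP => // /Xlt; case.
Qed.

Lemma mark_count_gt0 m w : mark_count m w = 1%N -> exists2 n, (n < m)%N & first_mark n w.
Proof.
move=> c1; have [i] : exists i, (i < m)%N && (X i w == j%:R).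
  apply: contrapT => no; move: c1; rewrite /mark_count big1// => i _.
  by apply/eqP; rewrite eqb0; apply/negP => Xi; apply: no; exists i; rewrite ltn_ord.
move=> im; have ex : exists i, (i < m)%N && (X i w == j%:R) by exists i.
case: (ex_minnP ex) => n /andP[nm /eqP Xn] minn; exists n => //; split=> // l ln Xl.
by have := minn l; rewrite (ltn_trans ln nm) Xl eqxx leqNgt ln => /(_ isT).
Qed.

(** The default branch of [renewal_count] gives an empty sum, so the value 1 certifies that a last
    arrival index exists. *)
Lemma jump_count_eq1 s w : jump_count J X j s w = 1%N <->
  exists n, [/\ arrival_time J n w <= s,
    forall m, (n < m)%N -> s < arrival_time J m w & mark_count n w = 1%N].
Proof.
rewrite /jump_count /renewal_count; split=> [|[n [Sn lastn c1]]].
  rewrite -/(mark_count _ w); case: xgetP => [n _ [Sn lastn] c1|_]; last by rewrite /mark_count big_ord0.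
  by exists n; split => // m; rewrite ltNge; apply: contraTN => /lastn; rewrite leqNgt.
rewrite (@xget_unique _ _ _ n) //.
- by split => // m; apply: contraTT; rewrite -ltnNge -ltNge; exact: lastn.
- move=> m [Sm lastm]; apply/eqP; rewrite eqn_leq lastm// andbT leqNgt.
  by apply/negP => /lastn; rewrite ltNge Sm.
Qed.

(* Countably many candidate times suffice, even on the null set of paths where the arrival
   times are not increasing; hence the event itself is measurable. *)
Lemma first_hit_lt s w : (first_hit J X j w < s%:E)%E <->
  exists n, mark_count n w = 1%N /\
    ((0 < arrival_time J n w < s /\
      forall m, (n < m)%N -> arrival_time J n w < arrival_time J m w) \/
     exists q : nat, [/\ q.+1%:R^-1 < s, arrival_time J n w <= q.+1%:R^-1 &
      forall m, (n < m)%N -> q.+1%:R^-1 < arrival_time J m w]).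
Proof.
split.
  move/ereal_inf_ltP => [_ [u [u0 /jump_count_eq1[n [Sn lastn c1]]] <-]]; rewrite lte_fin => us.
  exists n; split => //; have [S0|S0] := ltP 0 (arrival_time J n w).
    left; split; first by rewrite (le_lt_trans Sn).
    by move=> m /lastn; exact: le_lt_trans.
  (* A nonpositive arrival time is not an admissible [s], but every time in ]0, u] has the same last
     arrival index [n]. *)
  have [q qu] : exists q : nat, q.+1%:R^-1 < u.
    exists (Num.truncn u^-1); rewrite -[ltRHS]invrK ltf_pV2 ?posrE ?invr_gt0//.
    exact: truncnS_gt.
  right; exists q; split; first exact: lt_trans us.
    by rewrite (le_trans S0)// invr_ge0.
  by move=> m /lastn; exact: lt_trans.
move=> [n [c1 H]]; apply/ereal_inf_ltP.
case: H => [[/andP[S0 Ss] lastn]|[q [qs Sq lastn]]].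
  exists (arrival_time J n w)%:E; rewrite ?lte_fin//; exists (arrival_time J n w) => //.
  by split => //; apply/jump_count_eq1; exists n.
exists (q.+1%:R^-1)%:E; rewrite ?lte_fin//; exists (q.+1%:R^-1) => //.
by split; [rewrite invr_gt0|apply/jump_count_eq1; exists n].
Qed.

Lemma lt_arrival_time w : (forall i, 0 < J i w) ->
  {homo (arrival_time J)^~ w : n m / (n < m)%N >-> n < m}.
Proof.
move=> J0; apply: homo_ltn => [? ? ?|n]; first exact: lt_trans.
by rewrite /arrival_time big_ord_recr/= ltrDl.
Qed.

(** At the arrival time number n + 1 the later ones are strictly larger, so the maximum defining the
    count exists there even if arrivals accumulate afterwards. Conversely, a count of 1 requires at
    least n + 1 arrivals. *)
Lemma first_hitE n w : (forall i, 0 < J i w) -> first_mark n w ->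
  first_hit J X j w = (arrival_time J n.+1 w)%:E.
Proof.
move=> J0 fn; have ltS := lt_arrival_time J0; apply/eqP; rewrite eq_le; apply/andP; split.
  apply: ereal_inf_lbound; exists (arrival_time J n.+1 w) => //; split.
    by have := ltS 0%N n.+1 isT; rewrite {1}/arrival_time big_ord0.
  apply/jump_count_eq1; exists n.+1; split => //; last exact: mark_count_first.
  by move=> m; exact: ltS.
apply: le_ereal_inf_tmp => _ [s [s0 /jump_count_eq1[m [Sm _ c1]]] <-].
rewrite lee_fin (le_trans _ Sm)//.
have [i im [Xi Xlt]] := mark_count_gt0 c1.
have ni : (n <= i)%N by rewrite leqNgt; apply/negP => /(fn.2 i).
have := leq_ltn_trans ni im; rewrite leq_eqVlt => /predU1P[->//|/ltS/ltW//].
Qed.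

Lemma first_hit_le t w : (forall i, 0 < J i w) ->
  (first_hit J X j w <= t%:E)%E <->
  exists n, arrival_time J n.+1 w <= t /\ first_mark n w.
Proof.
move=> J0; split=> [ht|[n [St fn]]]; last by rewrite (first_hitE J0 fn) lee_fin.
(* Any finite strict bound would do: it only serves to produce a mark equal to [j]. *)
have : (first_hit J X j w < (t + 1)%:E)%E by rewrite (le_lt_trans ht)// lte_fin ltrDl.
move=> /first_hit_lt[m [/mark_count_gt0[n _ fn] _]]; exists n; split => //.
by rewrite -lee_fin -(first_hitE J0 fn).
Qed.

End first_hit_paths.

(** * Measurability of the hitting event *)

Section first_hit_measurable.
Context d {T : measurableType d} {R : realType}.
Variables (J X : nat -> T -> R) (j : nat).
Hypotheses (mJ : forall i, measurable_fun [set: T] (J i))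
  (mX : forall i, measurable_fun [set: T] (X i)).

Lemma measurable_arrival_time n : measurable_fun [set: T] (arrival_time J n).
Proof. by apply: measurable_sum => i; exact: mJ. Qed.

Let measurable_lt (f g : T -> R) : measurable_fun [set: T] f -> measurable_fun [set: T] g ->
  measurable [set w | f w < g w].
Proof.
move=> mf mg; rewrite -[X in measurable X]setTI.
by have := measurable_fun_ltr mf mg; move/(_ measurableT [set true]); apply.
Qed.

Let measurable_le (f g : T -> R) : measurable_fun [set: T] f -> measurable_fun [set: T] g ->
  measurable [set w | f w <= g w].
Proof.
move=> mf mg; rewrite -[X in measurable X]setTI.
by have := measurable_fun_ler mf mg; move/(_ measurableT [set true]); apply.
Qed.

Lemma measurable_mark i : measurable [set w | X i w = j%:R].
Proof. exact: (measurable_preimage (mX i) (measurable_set1 (j%:R : R))). Qed.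

Lemma measurable_mark_count n k : measurable [set w | mark_count X j n w = k].
Proof.
elim: n k => [|n IH] k.
  rewrite (_ : [set _ | _] = if k == 0%N then setT else set0).
    by case: ifP.
  by apply/seteqP; split => w /=; rewrite /mark_count big_ord0; case: k.
rewrite (_ : [set _ | _] = ([set w | mark_count X j n w = k] `&` ~` [set w | X n w = j%:R])
   `|` (if k is k'.+1 then [set w | mark_count X j n w = k'] `&` [set w | X n w = j%:R] else set0)).
  apply: measurableU; last by case: k => // k; apply: measurableI => //; exact: measurable_mark.
  by apply: measurableI => //; apply: measurableC; exact: measurable_mark.
apply/seteqP; split => w /=; rewrite mark_countS.
  case: eqP => Xn; last by rewrite addn0 => ->; left.
  by rewrite addn1 => <-; right.
case=> [[-> /eqP/negbTE ->]|]; first by rewrite addn0.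
by case: k => // k [-> ->]; rewrite eqxx addn1.
Qed.

Lemma measurable_first_mark n : measurable (first_mark X j n).
Proof.
rewrite (_ : first_mark X j n = [set w | X n w = j%:R] `&`
   \bigcap_i (if (i < n)%N then ~` [set w | X i w = j%:R] else setT)).
  apply: measurableI; first exact: measurable_mark.
  apply: bigcap_measurable => // i _; case: ifP => // _.
  by apply: measurableC; exact: measurable_mark.
apply/seteqP; split => w [Xn Xlt]; split => // i; first by move=> _; case: ifP => // /Xlt.
by move=> ilt; have := Xlt i I; rewrite ilt.
Qed.

Lemma measurable_first_hit_le (t : R) :
  measurable [set w | (first_hit J X j w <= t%:E)%E].
Proof.
have mS := measurable_arrival_time.
(* The infimum need not be attained on every path; the countable description is available for strict
   inequalities, which are intersected over bounds decreasing to [t]. *)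
rewrite (_ : [set _ | _] = \bigcap_i [set w | (first_hit J X j w < (t + i.+1%:R^-1)%:E)%E]).
  apply: bigcap_measurable => // i _; set s := t + _.
  rewrite (_ : [set _ | _] = \bigcup_n ([set w | mark_count X j n w = 1%N] `&`
    (([set w | 0 < arrival_time J n w] `&` [set w | arrival_time J n w < s] `&`
      \bigcap_(m in [set m | (n < m)%N]) [set w | arrival_time J n w < arrival_time J m w]) `|`
     \bigcup_(q in [set q : nat | q.+1%:R^-1 < s]) ([set w | arrival_time J n w <= q.+1%:R^-1] `&`
      \bigcap_(m in [set m | (n < m)%N]) [set w | q.+1%:R^-1 < arrival_time J m w])))).
    apply: bigcup_measurable => n _; apply: measurableI; first exact: measurable_mark_count.
    apply: measurableU.
      apply: measurableI; first by apply: measurableI; apply: measurable_lt.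
      by apply: bigcap_measurable => [|m _]; [exists n.+1 => /=; exact: ltnSn|exact: measurable_lt].
    apply: bigcup_measurable => q _; apply: measurableI; first exact: measurable_le.
    by apply: bigcap_measurable => [|m _]; [exists n.+1 => /=; exact: ltnSn|exact: measurable_lt].
  apply/seteqP; split => w.
    move=> /first_hit_lt[n [c1 H]]; exists n => //; split => //.
    case: H => [[/andP[S0 Ss] lastn]|[q [qs Sq lastn]]]; first by left.
    by right; exists q.
  move=> [n _ [c1 H]]; apply/first_hit_lt; exists n; split => //.
  case: H => [[[S0 Ss] lastn]|[q qs [Sq lastn]]].
    by left; split => //; apply/andP.
  by right; exists q.
apply/seteqP; split => w /= H.
  by move=> i _ /=; rewrite (le_lt_trans H)// lte_fin ltrDl invr_gt0.
apply/lee_addgt0Pr => e e0.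
have := H (Num.truncn e^-1) I => /ltW/le_trans; apply; rewrite -EFinD lee_fin lerD2l.
by rewrite -[leRHS]invrK lef_pV2 ?posrE ?invr_gt0// ltW// truncnS_gt.
Qed.

End first_hit_measurable.

Definition times_and_marks {T : Type} {R : realType} (J X : nat -> T -> R) (z : nat + nat) :=
  match z with inl i => J i | inr i => X i end.

Definition cylinder {T I : Type} {R : realType} (Y : I -> T -> R) (s : seq I) (B : I -> set R) :=
  \big[setI/setT]_(z <- s) (Y z @^-1` B z).

Lemma measurable_cylinder d {T : measurableType d} (I : Type) {R : realType}
    (Y : I -> T -> R) (s : seq I) (B : I -> set R) :
  (forall z, measurable_fun [set: T] (Y z)) -> (forall z, measurable (B z)) ->
  measurable (cylinder Y s B).
Proof.
by move=> mY mB; apply: bigsetI_measurable => z _; exact: measurable_preimage.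
Qed.

(** * Independence of arrival times and marks, and the law of the hitting time *)

Section renewal_marks.
Context d {T : measurableType d} {R : realType} (P : probability T R).
Variables J X : nat -> T -> R.
Local Notation Y := (times_and_marks J X).
Hypotheses (mJ : forall i, measurable_fun [set: T] (J i))
  (mX : forall i, measurable_fun [set: T] (X i))
  (indep : mutually_independent P Y).

Let measurable_cylinderY s B : (forall z, measurable (B z)) -> measurable (cylinder Y s B).
Proof. by move=> mB; apply: measurable_cylinder => // -[]. Qed.

Lemma arrival_time0 w : arrival_time J 0 w = 0.
Proof. by rewrite /arrival_time big_ord0. Qed.

Lemma arrival_timeS n w : arrival_time J n.+1 w = arrival_time J n w + J n w.
Proof. by rewrite /arrival_time big_ord_recr. Qed.

Let addset (A : set R) : set (measurableTypeR R * measurableTypeR R) :=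
  [set z | A (z.1 + z.2)].

Let measurable_addset A : measurable A -> measurable (addset A).
Proof.
move=> mA; rewrite -[addset A]setTI.
have mD : measurable_fun [set: measurableTypeR R * measurableTypeR R]
    (fun z : measurableTypeR R * measurableTypeR R => (z.1 + z.2 : R)).
  by apply: measurable_funD; [exact: measurable_fst|exact: measurable_snd].
exact: mD.
Qed.

Let arrivalS_preimage n A :
  arrival_time J n.+1 @^-1` A = (fun w => (J n w, arrival_time J n w)) @^-1` addset A.
Proof. by apply/seteqP; split => w; rewrite /addset/= arrival_timeS addrC. Qed.

(** The value is left as a product measure because it serves twice: for the independence of the next
    arrival time and, with an empty cylinder, for its law. *)
Let arrival_indep_step n :
  (forall s B, uniq s -> (forall i, (i < n)%N -> inl i \notin s) ->
    (forall z, measurable (B z)) -> forall A, measurable A ->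
    P (arrival_time J n @^-1` A `&` cylinder Y s B) =
    (P (arrival_time J n @^-1` A) * P (cylinder Y s B))%E) ->
  forall s B, uniq s -> (forall i, (i < n.+1)%N -> inl i \notin s) ->
    (forall z, measurable (B z)) -> forall A, measurable A ->
    P (arrival_time J n.+1 @^-1` A `&` cylinder Y s B) =
    ((rv_law P (mJ n) \x rv_law P (measurable_arrival_time mJ n)) (addset A) *
     P (cylinder Y s B))%E.
Proof.
move=> IH s B us ns mB A mA; rewrite arrivalS_preimage.
apply: joint_law_restr; [exact: measurable_cylinderY| |exact: measurable_addset].
move=> A1 A2 mA1 mA2.
(* The constraint on [J n] is moved into the cylinder, so that the induction hypothesis applies to
   the arrival time number [n], which does not involve [J n]. *)
pose B' z := if z == inl n then A1 else B z.
have mB' z : measurable (B' z) by rewrite /B'; case: ifP.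
have nn : inl n \notin s by exact: ns.
have eqB z : z \in s -> B' z = B z.
  by move=> zs; rewrite /B'; case: eqP => // zn; rewrite zn (negbTE nn) in zs.
have cylE : cylinder Y (inl n :: s) B' = J n @^-1` A1 `&` cylinder Y s B.
  rewrite /cylinder big_cons {1}/B' eqxx; congr (_ `&` _).
  by apply: eq_big_seq => z zs; rewrite eqB.
have us' : uniq (inl n :: s) by rewrite /= nn.
rewrite setICA -cylE IH//; last first.
  move=> i ilt; rewrite inE negb_or ns ?andbT; last by rewrite ltnS ltnW.
  by apply: contraTneq ilt => -[->]; rewrite ltnn.
rewrite muleCA; congr (_ * _)%E.
rewrite /cylinder !indep// big_cons {1}/B' eqxx; congr (_ * _)%E.
by apply: eq_big_seq => z zs; rewrite eqB.
Qed.

(** Cylinders may also constrain interarrival times of index at least [n]; the induction needs this,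
    since it adds a constraint on [J n]. *)
Lemma arrival_time_indep n s B : uniq s -> (forall i, (i < n)%N -> inl i \notin s) ->
  (forall z, measurable (B z)) -> forall A, measurable A ->
  P (arrival_time J n @^-1` A `&` cylinder Y s B) =
  (P (arrival_time J n @^-1` A) * P (cylinder Y s B))%E.
Proof.
elim: n s B => [|n IH] s B us ns mB A mA.
  have [A0|A0] := pselect (A 0).
    rewrite (_ : _ @^-1` A = setT) ?setTI ?probability_setT ?mul1e//.
    by apply/seteqP; split => w //= _; rewrite arrival_time0.
  rewrite (_ : _ @^-1` A = set0) ?set0I ?measure0 ?mul0e//.
  by apply/seteqP; split => w //=; rewrite arrival_time0.
rewrite (arrival_indep_step IH)//; congr (_ * _)%E.
have := @arrival_indep_step n IH [::] (fun=> setT) isT (fun _ _ => isT)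
  (fun=> measurableT) A mA.
by rewrite /cylinder big_nil setIT probability_setT mule1 => <-.
Qed.

Lemma arrival_timeS_law n (A : set R) : measurable A ->
  (P (arrival_time J n.+1 @^-1` A) =
  \int[rv_law P (mJ n)]_x P (arrival_time J n @^-1` [set y | A (x + y)%R]))%E.
Proof.
move=> mA.
have := @arrival_indep_step n (@arrival_time_indep n) [::] (fun=> setT) isT (fun _ _ => isT)
  (fun=> measurableT) A mA.
rewrite /cylinder big_nil setIT probability_setT mule1 => ->.
apply: eq_integral => x _ /=; rewrite rv_lawE; congr (P _).
by apply/seteqP; split => w; rewrite /xsection/= inE.
Qed.

Variables nu L : R.
Hypothesis nu0 : 0 < nu.
Hypothesis lawJ : forall i (A : set R), measurable A ->
  P (J i @^-1` A) =
  (\int[@lebesgue_measure R]_(x in A `&` `]0%R, +oo[) (ml_density nu L x)%:E)%E.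

Lemma interarrival_le0 i : P (J i @^-1` `]-oo, 0%R]) = 0.
Proof.
rewrite lawJ// (_ : _ `&` _ = set0) ?integral_set0//.
apply/seteqP; split => x //= []; rewrite !in_itv/= andbT => x0 /lt_le_trans/(_ x0).
by rewrite ltxx.
Qed.

Lemma interarrival_eq i u : P (J i @^-1` [set u]) = 0.
Proof.
by rewrite lawJ//; apply: integral_Sset1; exact: subIsetl.
Qed.

Definition nonpositive_path : set T := \bigcup_i J i @^-1` `]-oo, 0%R].

Lemma measurable_nonpositive_path : measurable nonpositive_path.
Proof. by apply: bigcup_measurable => i _; exact: measurable_preimage. Qed.

Lemma probability_nonpositive_path : P nonpositive_path = 0.
Proof.
apply: (measure_negligible measurable_nonpositive_path).
apply: negligible_bigcup => i; exists (J i @^-1` `]-oo, 0%R]); split => //.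
  exact: measurable_preimage.
exact: interarrival_le0.
Qed.

Lemma interarrival_gt0 w : (~` nonpositive_path) w -> forall i, 0 < J i w.
Proof.
move=> gw i; rewrite ltNge; apply/negP => Ji; apply: gw.
by exists i => //=; rewrite in_itv.
Qed.

Definition arrival_cdf n u : R := fine (P (arrival_time J n @^-1` `]-oo, u])).

Let measurable_arrival_le n u : measurable (arrival_time J n @^-1` `]-oo, u]).
Proof. exact: measurable_preimage (measurable_arrival_time mJ n) (measurable_itv _). Qed.

Lemma EFin_arrival_cdf n u :
  (arrival_cdf n u)%:E = P (arrival_time J n @^-1` `]-oo, u]).
Proof. by rewrite fineK// fin_num_measure. Qed.

Lemma arrival_cdf_ge0 n u : 0 <= arrival_cdf n u.
Proof. by rewrite -lee_fin EFin_arrival_cdf measure_ge0. Qed.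

Lemma arrival_cdf_le1 n u : arrival_cdf n u <= 1.
Proof. by rewrite -lee_fin EFin_arrival_cdf probability_le1. Qed.

Lemma arrival_cdf_lt0 n u : u < 0 -> arrival_cdf n u = 0.
Proof.
move=> u0; apply: EFin_inj; rewrite EFin_arrival_cdf.
apply: (subset_measure0 _ measurable_nonpositive_path _ probability_nonpositive_path) => // w /=.
rewrite in_itv/= => Su; apply: contrapT => /interarrival_gt0 J0.
have := le_lt_trans Su u0; rewrite ltNge /arrival_time sumr_ge0// => i _.
exact: ltW.
Qed.

Lemma arrival_cdf0 u : 0 <= u -> arrival_cdf 0 u = 1.
Proof.
move=> u0; apply: EFin_inj; rewrite EFin_arrival_cdf (_ : _ @^-1` _ = setT).
  exact: probability_setT.
by apply/seteqP; split => w //= _; rewrite in_itv/= arrival_time0.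
Qed.

Lemma measurable_arrival_cdf n : measurable_fun [set: R] (arrival_cdf n).
Proof.
apply: nondecreasing_measurable => // u v uv.
rewrite -lee_fin !EFin_arrival_cdf; apply: le_measure; rewrite ?inE//.
by move=> w /=; rewrite !in_itv/= => /le_trans; apply.
Qed.

Lemma arrival_cdfS n u : 0 < u ->
  arrival_cdf n.+1 u = law_conv (rv_law P (mJ 0)) (arrival_cdf n) u.
Proof.
move=> u0; rewrite {1}/arrival_cdf /law_conv /Rintegral arrival_timeS_law//.
congr fine.
have mF : measurable_fun [set: R] (fun x => (arrival_cdf n (u - x))%:E).
  apply/measurable_EFinP; apply: (measurableT_comp (measurable_arrival_cdf n)).
  exact: measurable_funB.
transitivity (\int[rv_law P (mJ n)]_x (arrival_cdf n (u - x))%:E)%E.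
  apply: eq_integral => x _; rewrite EFin_arrival_cdf; congr (P _).
  by apply/seteqP; split => w /=; rewrite !in_itv/= lerBrDl.
transitivity (\int[rv_law P (mJ 0)]_x (arrival_cdf n (u - x))%:E)%E.
  by apply: eq_measure_integral => A mA _; exact: (etrans (lawJ n mA) (esym (lawJ 0 mA))).
rewrite [RHS]integral_mkcond; apply: ge0_ae_eq_integral => //.
- exact/(measurable_restrictT _ _).1/measurable_funTS.
- by move=> x _; rewrite lee_fin arrival_cdf_ge0.
- by move=> x _; apply: erestrict_ge0 => y _; rewrite lee_fin arrival_cdf_ge0.
(* Beyond [u] the integrand vanishes. At [x = u] it equals [arrival_cdf n 0], which is 1 for n = 0,
   so the absence of atoms is used. *)
exists (`]-oo, 0%R] `|` [set u]); split.
- by apply: measurableU.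
- apply: measure_negligible; first by apply: measurableU.
  by apply: negligibleU; apply/negligibleP => //; [exact: interarrival_le0|exact: interarrival_eq].
move=> x /= H; apply: contrapT => nx; apply: H => _.
rewrite patchE; case: ifPn => //; rewrite notin_setE/= in_itv/=.
move=> /negP; rewrite negb_and -!leNgt => /orP[x0|ux].
  by exfalso; apply: nx; left; rewrite /= in_itv.
rewrite arrival_cdf_lt0// subr_lt0 lt_neqAle ux andbT eq_sym.
by apply/eqP => xu; apply: nx; right.
Qed.

Variables (l : R) (j : nat).
Hypotheses (l0 : 0 < l) (lL : l <= L)
  (markP : forall i, P (X i @^-1` [set j%:R]) = (l / L)%:E).

Let prod_const (I : eqType) (s : seq I) (f : I -> \bar R) (q : R) :
  {in s, forall i, f i = q%:E} -> (\prod_(i <- s) f i = (q ^+ size s)%:E)%E.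
Proof.
elim: s => [|i s IH] fq; first by rewrite big_nil.
rewrite big_cons fq ?mem_head// IH ?exprS -?EFinM//.
by move=> x xs; rewrite fq// inE xs orbT.
Qed.

Let first_mark_arrival n t :
  P (arrival_time J n.+1 @^-1` `]-oo, t] `&` first_mark X j n) =
  (l / L * (1 - l / L) ^+ n * arrival_cdf n.+1 t)%:E.
Proof.
(* The first occurrence of [j] constrains marks only. The index [n] comes last so that the product
   splits into [n] factors [1 - l / L] and one factor [l / L]. *)
pose s := rcons [seq (inr i : nat + nat) | i <- iota 0 n] (inr n).
pose B (z : nat + nat) : set R := if z is inr i then
  if (i < n)%N then ~` [set j%:R] else [set j%:R] else setT.
have mB z : measurable (B z).
  have m1 : measurable [set j%:R : R] by exact: measurable_set1.
  by case: z => [i|i]; rewrite /B//; case: ifP => // _; apply: measurableC.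
have us : uniq s.
  rewrite rcons_uniq map_inj_uniq ?iota_uniq ?andbT; last by move=> ? ? [].
  by apply/mapP => -[i]; rewrite mem_iota add0n => /andP[_ ilt] [ni]; rewrite ni ltnn in ilt.
have ns i : (i < n.+1)%N -> inl i \notin s.
  by move=> _; rewrite mem_rcons inE /=; apply/mapP => -[].
have -> : first_mark X j n = cylinder Y s B.
  rewrite /cylinder -bigcap_seq; apply/seteqP; split => w /=.
    move=> [Xn Xlt] z /=; rewrite mem_rcons inE => /predU1P[->|/mapP[i]].
      by rewrite /B ltnn.
    rewrite mem_iota add0n => /andP[_ ilt] ->; rewrite /B ilt /=; exact: Xlt.
  move=> H; split.
    by have := H (inr n); rewrite /= mem_rcons mem_head /B ltnn; exact.
  move=> i ilt; have := H (inr i); rewrite /= mem_rcons inE /B ilt; apply.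
  by rewrite (mem_map (fun _ _ => _)) ?mem_iota ?add0n ?ilt ?orbT//; move=> ? ? [].
rewrite arrival_time_indep// -EFin_arrival_cdf muleC [RHS]EFinM; congr (_ * _)%E.
rewrite /cylinder indep// big_rcons/= /B ltnn markP [RHS]EFinM [LHS]muleC; congr (_ * _)%E.
rewrite big_map (@prod_const _ _ _ (1 - l / L)) ?size_iota// => i.
rewrite mem_iota add0n => /andP[_ ilt]; rewrite /= ilt -preimage_setC probability_setC ?markP//.
exact: measurable_preimage.
Qed.

Let null_setD (A : set T) : measurable A -> P A = P (A `\` nonpositive_path).
Proof.
move=> mA; apply: (etrans (measureDI P mA measurable_nonpositive_path)).
rewrite (@subset_measure0 _ _ _ P (A `&` nonpositive_path) _ _ measurable_nonpositive_path) ?adde0//.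
- by apply: measurableI => //; exact: measurable_nonpositive_path.
- exact: probability_nonpositive_path.
Qed.

Lemma first_hit_probability t : 0 < t ->
  P [set w | (first_hit J X j w <= t%:E)%E] =
  (l * t `^ nu * mittag_leffler nu (nu + 1) (- l * t `^ nu))%:E.
Proof.
move=> t0.
(* Marks are numbered from 0: [X n] belongs to the arrival time number [n.+1]. *)
pose D n := arrival_time J n.+1 @^-1` `]-oo, t] `&` first_mark X j n.
have mD n : measurable (D n).
  apply: measurableI; first exact: measurable_preimage (measurable_arrival_time mJ _) _.
  exact: measurable_first_mark.
have mUD : measurable (\bigcup_n D n) by exact: bigcup_measurable.
have -> : P [set w | (first_hit J X j w <= t%:E)%E] = P (\bigcup_n D n).
  rewrite (null_setD (measurable_first_hit_le j mJ mX t)) (null_setD mUD).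
  congr (P _); apply/seteqP; split => w [H gw]; split => //.
    have [n [St fn]] := (first_hit_le X j t (interarrival_gt0 gw)).1 H.
    by exists n => //; split => //=; rewrite in_itv.
  have [n _ [/= St fn]] := H; rewrite in_itv/= in St.
  by apply/(first_hit_le X j t (interarrival_gt0 gw)); exists n.
have tD : trivIset setT D.
  apply/trivIsetP => m n _ _ mn; apply/seteqP; split => // w [[_ [Xm mlt]] [_ [Xn nlt]]].
  by have [/nlt|/mlt|] := ltngtP m n => //; move/eqP: mn.
have cvgD := measure_semi_sigma_additive _ mD tD mUD.
rewrite -(@fineK _ (P (\bigcup_n D n))) ?fin_num_measure//; congr EFin.
apply: (@renewal_mittag_leffler _ (rv_law P (mJ 0)) nu L l arrival_cdf) => //.
- by move=> A mA; exact: (lawJ 0 mA).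
- exact: measurable_arrival_cdf.
- by move=> n u; rewrite ger0_norm ?arrival_cdf_ge0// arrival_cdf_le1.
- by move=> u /ltW; exact: arrival_cdf0.
- by move=> n u; exact: arrival_cdfS.
suff : (fun n => (\sum_(0 <= i < n) l / L * (1 - l / L) ^+ i *
    arrival_cdf i.+1 t)%:E) @ \oo --> (fine (P (\bigcup_n D n)))%:E.
  by move=> /fine_cvgP[].
rewrite fineK ?fin_num_measure//.
rewrite [X in X @ _ --> _](_ : _ = fun n => (\sum_(0 <= i < n) P (D i))%E); first exact: cvgD.
by apply/funext => n; rewrite -sumEFin; apply: eq_bigr => i _; rewrite first_mark_arrival.
Qed.

End renewal_marks.

Theorem theorem3p1 (R : realType) (d : measure_display) (T : measurableType d)
  (P : probability T R) (nu : R) (k : nat) (lambda : nat -> R)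
  (J : nat -> T -> R) (X : nat -> T -> R) :
  0 < nu -> nu <= 1 ->
  (forall j : nat, (1 <= j <= k)%N -> 0 < lambda j) ->
  let Lam := \sum_(1 <= j < k.+1) lambda j in
  (* J i = (i+1)-th interarrival time of the fractional Poisson process of intensity Lam *)
  (forall i, measurable_fun setT (J i)) ->
  (forall i (A : set R), measurable A ->
     P (J i @^-1` A) =
     (\int[@lebesgue_measure R]_(x in A `&` `]0%R, +oo[)
        (Lam * x `^ (nu - 1) * mittag_leffler nu nu (- Lam * x `^ nu))%:E)%E) ->
  (* X i = (i+1)-th mark *)
  (forall i, measurable_fun setT (X i)) ->
  (forall i (j : nat), (1 <= j <= k)%N ->
     P (X i @^-1` [set j%:R]) = (lambda j / Lam)%:E) ->
  (* the interarrival times and the marks are all mutually independent *)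
  mutually_independent P (fun z : nat + nat =>
     match z with inl i => J i | inr i => X i end) ->
  forall (j : nat) (t : R), (1 <= j <= k)%N -> 0 < t ->
    P [set w | (first_hit J X j w <= t%:E)%E] =
    (lambda j * t `^ nu * mittag_leffler nu (nu + 1) (- lambda j * t `^ nu))%:E.
Proof.
move=> nu0 nu1 lam0 Lam mJ lawJ mX markP indep j t jk t0.
(* This yields [lambda j <= Lam], that is q >= 0, with equality allowed when k = 1. *)
have rest_ge0 : 0 <= \sum_(i <- index_iota 1 k.+1 | i != j) lambda i.
  rewrite big_seq_cond; apply: sumr_ge0 => i /andP[]; rewrite mem_index_iota ltnS => ik _.
  exact: ltW (lam0 _ ik).
have lamL : lambda j <= Lam.
  by rewrite /Lam (bigD1_seq j) ?iota_uniq ?mem_index_iota//= lerDl.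
exact: (first_hit_probability mJ mX indep nu0 lawJ (lam0 _ jk) lamL (fun i => markP i j jk) t0).
Qed.
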